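(* Let $\mathbf c_4\subset S_n$ be the conjugacy class of $4$-cycles and $u_n$ the uniform measure on $S_n$. For $n\ge 11$, $c\ge 2$ and every real $t\ge\frac n2(\log n+c)$, $$d_2\big(h_{\mathbf c_4,t},u_n\big)\le e^{-(c-2)}.$$
   Context: $q_{\mathbf c_4}$ is the uniform probability measure on the set $\mathbf c_4$ of $4$-cycles in $S_n$, $q^{(k)}$ denotes the $k$-fold convolution power, and $h_{\mathbf c_4,t}=e^{-t}\sum_{k\ge0}\frac{t^k}{k!}q_{\mathbf c_4}^{(k)}$. $d_2(p,u)=\big(|G|\sum_{x\in G}|p(x)-u(x)|^2\big)^{1/2}$ with $G=S_n$. *)

(* Defs.v *)
From Stdlib Require Import Reals ClassicalEpsilon.
From mathcomp Require Import all_boot all_fingroup.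
Set Implicit Arguments. Unset Strict Implicit. Unset Printing Implicit Defensive.

Local Open Scope group_scope.

Definition sumS (n : nat) (f : 'S_n -> R) : R := \big[Rplus/R0]_(x : {perm 'I_n}) f x.

Definition is_4cycle (n : nat) (s : 'S_n) : bool :=
  [exists x : 'I_n, (#|porbit s x| == 4)%N && [forall y : 'I_n, (y \notin porbit s x) ==> (s y == y)]].

Definition c4 (n : nat) : {set 'S_n} := [set s : 'S_n | is_4cycle s].

Definition q_c4 (n : nat) (x : 'S_n) : R :=
  if x \in c4 n then Rinv (INR #|c4 n|) else R0.

Definition unif (n : nat) (x : 'S_n) : R := Rinv (INR #|[set: 'S_n]|).

Definition conv (n : nat) (p q : 'S_n -> R) (x : 'S_n) : R :=
  sumS (fun y => Rmult (p y) (q (y^-1 * x))).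

Definition delta1 (n : nat) (x : 'S_n) : R := if x == 1 then R1 else R0.

Fixpoint convpow (n : nat) (q : 'S_n -> R) (k : nat) : 'S_n -> R :=
  match k with
  | O => @delta1 n
  | S k' => conv q (convpow q k')
  end.

Definition series_val (a : nat -> R) : R :=
  epsilon (inhabits R0) (fun l => infinite_sum a l).

Definition h_c4 (n : nat) (t : R) (x : 'S_n) : R :=
  Rmult (exp (Ropp t))
    (series_val (fun k => Rmult (Rdiv (pow t k) (INR (k`!))) (convpow (@q_c4 n) k x))).

Definition dist2 (n : nat) (p u : 'S_n -> R) : R :=
  sqrt (Rmult (INR #|[set: 'S_n]|) (sumS (fun x => pow (Rabs (Rminus (p x) (u x))) 2))).

(* Main.v *)
Require Import Defs.
From Stdlib Require Import Reals ClassicalEpsilon.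
From mathcomp Require Import all_boot all_fingroup.
From mathcomp Require Import all_order all_algebra all_field all_character.
From mathcomp Require Import zify ring lra reals Rstruct.
Set Implicit Arguments. Unset Strict Implicit. Unset Printing Implicit Defensive.
Import Order.TTheory GRing.Theory Num.Theory GroupScope.
Local Open Scope ring_scope.

(** Plancherel gives d_2(h_t, u)^2 = \sum_(i != 0) d_i^2 exp (- 2 t (1 - r_i)), where r_i is the
    eigenvalue of the normalized 4-cycle class sum on the irreducible module i of degree d_i.

    For an irreducible module V let m be the largest size of a set B such that V has a nonzero
    vector fixed by Sym B (the length of the first row of the partition of V), and j = n - m.
    V is spanned by the 'C(n, m) translates of the space fixed by Sym B, and these spaces have
    total weighted dimension \sum_V (dim V) (dim V^(Sym B)) = n! / m!; hence
    \sum_(V of level j) (dim V)^2 <= 'C(n, j) n^j.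

    Choosing disjoint sets B_1, B_2, ... greedily of maximal size produces a vector v fixed by
    every Sym B_k; by maximality, v symmetrized over B_k and one later point vanishes, so v is a
    joint eigenvector of the Jucys-Murphy elements whose eigenvalues are the contents of a
    diagram with rows |B_k|. As \sum_q X_q^3 = C_4 + (2 n - 3) \sum_q X_q, the class sum C_4 acts
    on V by \sum_x (x^3 - (2 n - 3) x) over these contents x.

    Bounding this sum gives n (1 - r) >= 2 j for j <= 2 n / 5, and n (1 - r) >= max (n / 2, j - 1)
    otherwise. At t = (n / 2) (log n + 2) the first range contributes at most
    \sum_(j >= 1) e^(-4 j) and the second at most n (2 / e)^n. *)

(** * Ranks of fixed spaces as traces *)

(** In a rank factorization [A = C B], idempotency forces [B C = 1], and [C B] and [B C] have the
    same trace. *)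
Lemma mxtrace_idempotent (F : fieldType) n (A : 'M[F]_n) :
  A *m A = A -> \tr A = (\rank A)%:R.
Proof.
move=> idA; move: (mulmx_base A) (col_base_full A) (row_base_free A).
move: (col_base A) (row_base A) => C B defA fullC freeB.
rewrite -{1}defA mxtrace_mulC (_ : B *m C = 1%:M) ?mxtrace1 //.
apply: (row_full_inj fullC); apply: (row_free_inj freeB).
by rewrite mulmx1 defA mulmxA defA -mulmxA defA.
Qed.

(** The average of [rG] over [H] is a projection onto the fixed space, so its trace is the rank of
    that space. *)
Lemma rank_rfix_mx (gT : finGroupType) (G H : {group gT}) d
    (rG : mx_representation algC G d) :
  H \subset G ->
  \sum_(h in H) \tr (rG h) = (#|H| * \rank (rfix_mx rG H))%:R.
Proof.
move=> sHG; pose e := \sum_(h in H) rG h.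
have eM x : x \in H -> e *m rG x = e.
  move=> Hx; rewrite /e mulmx_suml (reindex_inj (mulIg (x^-1)%g)) /=.
  apply: eq_big => [h|h Hh]; first by rewrite groupMr ?groupV.
  rewrite -repr_mxM ?mulgKV //; last exact: (subsetP sHG).
  by rewrite (subsetP sHG) // -(groupMr _ (groupVr Hx)).
have cH : #|H|%:R != 0 :> algC by rewrite pnatr_eq0 -lt0n cardG_gt0.
pose E := #|H|%:R^-1 *: e.
have fixE m (W : 'M_(m, d)) : (forall x, x \in H -> W *m rG x = W) -> W *m E = W.
  move=> fW; rewrite -scalemxAr /e mulmx_sumr (eq_bigr _ fW) sumr_const.
  by rewrite -scaler_nat scalerA mulVf // scale1r.
have EM x : x \in H -> E *m rG x = E by move=> Hx; rewrite -scalemxAl eM.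
have rfE : (rfix_mx rG H :=: E)%MS.
  apply/eqmxP/andP; split; last exact/rfix_mxP.
  by rewrite -[X in (X <= _)%MS](fixE _ (rfix_mx rG H)) ?submxMl // => x; apply: rfix_mx_id.
rewrite rfE natrM -(mxtrace_idempotent (fixE _ _ EM)) mxtraceZ mulrA divff // mul1r.
by rewrite raddf_sum.
Qed.

(** * Symmetric groups on subsets *)

Section Perm.
Variable T : finType.
Implicit Types (B C : {set T}) (s : {perm T}).

Lemma Sym_conjg B s : Sym B :^ s = Sym (s @: B).
Proof.
apply/setP=> t; rewrite mem_conjg !inE; apply/subsetP/subsetP => on_t x.
  rewrite inE => tx; have := on_t (s^-1 x)%g; rewrite inE.
  rewrite conjgE invgK !permM permKV (can2_eq (permKV s) (permK s)) permKV => /(_ tx) Bx.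
  by rewrite -[x](permKV s) imset_f.
rewrite inE conjgE invgK !permM => tx; have := on_t (s x); rewrite inE.
rewrite (can2_eq (permKV s) (permK s)) in tx => /(_ tx); by rewrite mem_imset //; apply: perm_inj.
Qed.

Lemma perm_imset_card B C : #|B| = #|C| -> exists s, s @: B = C.
Proof.
(* Each list starts with its set, so matching equal positions of [L B] and [L C] carries [B] onto
   [C]. *)
move=> eqBC; pose L (D : {set T}) := enum D ++ enum (~: D).
have mL D x : x \in L D by rewrite mem_cat !mem_enum inE orbN.
have uL D : uniq (L D).
  rewrite cat_uniq !enum_uniq andbT /=; apply/hasPn => x.
  by rewrite !mem_enum inE.
have sL D : size (L D) = #|T| by rewrite size_cat -!cardE cardsC.
have inj : injective (fun x => nth x (L C) (index x (L B))).
  move=> x y; rewrite (set_nth_default y) ?sL -?(sL B) ?index_mem // => /eqP.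
  rewrite nth_uniq ?sL -?(sL B) ?index_mem // => /eqP.
  by move/(congr1 (nth x (L B))); rewrite !nth_index.
exists (perm inj); apply/eqP; rewrite eqEcard card_imset ?eqBC ?leqnn ?andbT; last exact: perm_inj.
apply/subsetP => _ /imsetP[x Bx ->]; rewrite permE.
have ix : (index x (L B) < #|B|)%N by rewrite index_cat mem_enum Bx cardE index_mem mem_enum.
by rewrite nth_cat -cardE -eqBC ix -mem_enum mem_nth // -cardE -eqBC.
Qed.

End Perm.

Lemma mxrank_sum_le (F : fieldType) n (I : finType) (P : pred I) (A : I -> 'M[F]_n) : (\rank (\sum_(i | P i) A i)%MS <= \sum_(i | P i) \rank (A i))%N.
Proof.
elim/big_rec2: _ => [|i y x _ IH]; first by rewrite mxrank0.
by apply: leq_trans (mxrank_adds_leqif _ _) _; rewrite leq_add2l.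
Qed.

(** * Spaces fixed by [Sym B] and the first row length *)

Section FirstRow.
Variables (n d : nat) (rG : mx_representation algC [set: 'S_n] d).

Definition first_row := \max_(B : {set 'I_n} | rfix_mx rG (Sym B) != 0) #|B|.

Lemma rfix_Sym_imset (B : {set 'I_n}) (s : 'S_n) :
  (rfix_mx rG (Sym (s @: B)) :=: rfix_mx rG (Sym B) *m rG s)%MS.
Proof. by rewrite -Sym_conjg; apply: rfix_mx_conjsg; rewrite ?inE ?subsetT. Qed.

Lemma rank_rfix_Sym (B C : {set 'I_n}) :
  #|B| = #|C| -> \rank (rfix_mx rG (Sym B)) = \rank (rfix_mx rG (Sym C)).
Proof.
move=> /perm_imset_card[s <-]; rewrite rfix_Sym_imset mxrankMfree //.
by rewrite row_free_unit repr_mx_unit ?inE.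
Qed.

(* The sum of the translates of the space fixed by [Sym B] is a nonzero submodule. *)
Lemma degree_le_rank_rfix (B : {set 'I_n}) :
  mx_irreducible rG -> rfix_mx rG (Sym B) != 0 ->
  (d <= 'C(n, #|B|) * \rank (rfix_mx rG (Sym B)))%N.
Proof.
move=> /mx_irrP[_ irrG] nzB.
pose U := (\sum_(C : {set 'I_n} | #|C| == #|B|) rfix_mx rG (Sym C))%MS.
have modU : mxmodule rG U.
  apply/mxmoduleP=> s _; rewrite sumsmxMr_gen; apply/sumsmx_subP => C cardC.
  rewrite genmxE -rfix_Sym_imset (sumsmx_sup (s @: C)) // card_imset //.
  exact: perm_inj.
have nzU : U != 0.
  by apply: contraNneq nzB => U0; rewrite -submx0 -U0 (sumsmx_sup B).
have /eqP rkU := irrG U modU nzU.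
rewrite -[X in (X <= _)%N]rkU; apply: leq_trans (mxrank_sum_le _ _) _.
rewrite (eq_bigr (fun=> \rank (rfix_mx rG (Sym B)))) => [|C /eqP]; last exact: rank_rfix_Sym.
rewrite sum_nat_const leq_mul2r -[n in 'C(n, _)]card_ord -card_draws.
by rewrite cardE (eq_enum (_ : _ =i [set A : {set 'I_n} | #|A| == #|B|])) -?cardE ?leqnn ?orbT // => C; rewrite inE.
Qed.

Lemma Sym_card_le1 (T : finType) (B : {set T}) : (#|B| <= 1)%N -> Sym B = 1%g.
Proof.
move=> cardB; apply/setP => s; rewrite !inE; apply/idP/eqP => [on_s | ->]; last exact: perm_on1.
apply/permP => x; rewrite perm1; case: (boolP (x \in B)) => [Bx | /out_perm->] //.
have Bsx : s x \in B by rewrite perm_closed.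
have : #|B :\ x| == 0 by move: cardB; rewrite (cardsD1 x) Bx add1n ltnS leqn0.
by rewrite cards_eq0 => /eqP/setP/(_ (s x)); rewrite !inE Bsx andbT => /eqP.
Qed.

Lemma rfix_Sym_card_le1 (B : {set 'I_n}) :
  (0 < d)%N -> (#|B| <= 1)%N -> rfix_mx rG (Sym B) != 0.
Proof.
move=> d_gt0 /Sym_card_le1->; apply: contraTneq d_gt0 => W0.
rewrite -leqNgt leqn0 -[d](mxrank1 algC) -leqn0 -(mxrank0 algC d d) -W0 mxrankS //.
by apply/rfix_mxP => x /set1P->; rewrite repr_mx1 mulmx1.
Qed.

Lemma first_row_attained : (0 < d)%N ->
  exists2 B : {set 'I_n}, rfix_mx rG (Sym B) != 0 & #|B| = first_row.
Proof.
move=> d_gt0; rewrite /first_row.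
have [|B nzB ->] := @eq_bigmax_cond _ [pred B : {set 'I_n} | rfix_mx rG (Sym B) != 0] (fun B : {set 'I_n} => #|B|).
  by apply/card_gt0P; exists set0; rewrite inE rfix_Sym_card_le1 ?cards0.
by exists B.
Qed.

Lemma card_le_first_row (B : {set 'I_n}) : rfix_mx rG (Sym B) != 0 -> (#|B| <= first_row)%N.
Proof.
by move=> nzB; apply: (@leq_bigmax_cond _ _ (fun B : {set 'I_n} => #|B|)).
Qed.

Lemma first_row_gt0 : (0 < d)%N -> (0 < n)%N -> (0 < first_row)%N.
Proof.
move=> d_gt0 n_gt0; rewrite -(cards1 (Ordinal n_gt0)) card_le_first_row //.
by rewrite rfix_Sym_card_le1 ?cards1.
Qed.

Lemma first_row_le : (first_row <= n)%N.
Proof. by apply/bigmax_leqP => B _; rewrite -[n in (_ <= n)%N]card_ord max_card. Qed.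

End FirstRow.

(** * Dimension counts by first row length *)

Section Levels.
Variable n : nat.
Local Notation G := [set: 'S_n]%G.
Implicit Type i : Iirr G.

Definition deg i : nat := irr_degree (socle_of_Iirr i).

Lemma deg_gt0 i : (0 < deg i)%N. Proof. exact: irr_degree_gt0. Qed.

Lemma mxtrace_Chi i (s : 'S_n) : \tr ('Chi_i s) = 'chi_i s.
Proof. by rewrite -irrRepr cfunE inE. Qed.

Lemma sum_deg_irr (s : 'S_n) : \sum_i (deg i)%:R * 'chi[G]_i s = (n`!)%:R *+ (s == 1%g).
Proof.
have <- : #|G| = n`! by rewrite cardsT card_Sn.
rewrite -cfRegE cfReg_sum sum_cfunE; apply: eq_bigr => i _.
by rewrite cfunE irr1_degree.
Qed.

(** The regular character is summed over [Sym B] in two ways: only the identity contributes, and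
    each irreducible contributes by [rank_rfix_mx]. *)
Lemma sum_deg_rank_rfix (B : {set 'I_n}) :
  (\sum_i deg i * \rank (rfix_mx 'Chi_i (Sym B)) * #|B|`!)%N = n`!.
Proof.
apply/eqP; rewrite -(eqr_nat algC) natr_sum; apply/eqP.
transitivity (\sum_(h in Sym B) \sum_i (deg i)%:R * 'chi[G]_i h).
  rewrite exchange_big; apply: eq_bigr => i _ /=.
  rewrite -mulr_sumr -mulnA [X in (_ * X)%N]mulnC natrM; congr (_ * _).
  rewrite -card_Sym -rank_rfix_mx ?subsetT //.
  by apply: eq_bigr => h _; rewrite mxtrace_Chi.
rewrite (eq_bigr _ (fun h _ => sum_deg_irr h)) (bigD1 1%g) ?group1 //= eqxx.
by rewrite big1 ?addr0 // => h /andP[_ /negPf->].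
Qed.

(** One of the two factors [deg i] is bounded by [degree_le_rank_rfix]; the other is summed by
    [sum_deg_rank_rfix]. *)
Lemma sum_deg_sq_first_row m :
  (\sum_(i | first_row 'Chi_i == m) deg i ^ 2 * m`! <= 'C(n, m) * n`!)%N.
Proof.
have [i0 /eqP fr0 | no_i] := pickP (fun i => first_row 'Chi_i == m); last by rewrite big_pred0.
have [B nzB cardB] := first_row_attained 'Chi_i0 (deg_gt0 i0).
rewrite -(sum_deg_rank_rfix B) big_distrr /= big_mkcond; apply: leq_sum => i _.
case: eqP => // fri; rewrite cardB fr0 mulnA leq_mul2r; apply/orP; right.
have [C nzC cardC] := first_row_attained 'Chi_i (deg_gt0 i).
rewrite expnS expn1 mulnCA leq_mul2l; apply/orP; right.
rewrite (@rank_rfix_Sym _ _ _ B C) ?cardC ?cardB ?fr0 ?fri // -fri -cardC.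
by apply: degree_le_rank_rfix => //; apply: socle_irr.
Qed.

(** The whole group then has a nonzero fixed space, which is all of the module by irreducibility;
    the sum of the character is nonzero, against orthogonality to the trivial one. *)
Lemma first_row_eq_n i : first_row 'Chi_i = n -> i = 0.
Proof.
move=> fri; have [B nzB cardB] := first_row_attained 'Chi_i (deg_gt0 i).
have BT : B = setT by apply/eqP; rewrite eqEcard subsetT cardsT card_ord cardB fri /=.
have SymT : Sym B = G by apply/setP => s; rewrite BT !inE; apply/subsetP => x _; rewrite inE.
have /mx_irrP[_ irrG] := socle_irr (socle_of_Iirr i).
have rk : \rank (rfix_mx 'Chi_i (Sym B)) = deg i.
  by apply/eqP/irrG => //; rewrite SymT; apply: rfix_mx_module.
have := rank_rfix_mx 'Chi_i (subxx G); rewrite -[X in rfix_mx _ X]SymT rk => sumG.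
apply/eqP/negPn/negP => nz_i; have := cfdot_irr i 0; rewrite (negPf nz_i) cfdotE.
rewrite (eq_bigr (fun s => \tr ('Chi_i s))) => [|s _]; last first.
  by rewrite irr0 cfun1E inE rmorph1 mulr1 mxtrace_Chi.
rewrite sumG => /eqP; rewrite mulf_eq0 invr_eq0 !pnatr_eq0 muln_eq0.
by rewrite !eqn0Ngt cardG_gt0 deg_gt0.
Qed.

Lemma deg0 : deg 0 = 1%N.
Proof. by apply/eqP; rewrite -(eqr_nat algC) -irr1_degree irr0 cfun1E group1. Qed.

End Levels.

(** * Contents (column minus row) of the cells of a diagram *)

Definition content_row t l : seq int := [seq (c%:Z - t%:Z) | c <- iota 0 l].

Lemma size_content_row t l : size (content_row t l) = l.
Proof. by rewrite size_map size_iota. Qed.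

Lemma nth_content_row t l q : (q < l)%N -> (nth 0 (content_row t l) q)%:~R = q%:R - t%:R :> algC.
Proof. by move=> ltql; rewrite (nth_map 0%N) ?size_iota // nth_iota // rmorphB. Qed.

(** Contents of consecutive rows from row [t] on. Only a common bound [M] on the row lengths is
    recorded, which is what the eigenvalue estimates use. *)
Inductive contents (M : nat) : nat -> seq int -> Prop :=
| contents_nil t : contents M t [::]
| contents_row t l e : (l <= M)%N -> contents M t.+1 e ->
    contents M t (content_row t l ++ e).

(** * Greedy choice of blocks *)

Section Greedy.
Variables (n d : nat) (rG : mx_representation algC [set: 'S_n] d).
Implicit Types (B : {set 'I_n}) (s : seq 'I_n) (W : 'M[algC]_d).

Lemma repr_mxMT (x y : 'S_n) : rG (x * y)%g = rG x *m rG y.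
Proof. by rewrite repr_mxM ?inE. Qed.

(** The Jucys-Murphy element of [a] when the points preceding it are those of [s]. *)
Definition star s a : 'M[algC]_d := \sum_(y <- s) rG (tperm y a).

(* [tperm y a], [y \in a |: B], represent the cosets of [Sym B] in [Sym (a |: B)]. *)
Lemma symmetrize_fixed B a m (v : 'M[algC]_(m, d)) :
  (v <= rfix_mx rG (Sym B))%MS -> a \notin B ->
  ((v + v *m star (enum B) a)%R <= rfix_mx rG (Sym (a |: B)))%MS.
Proof.
move=> /rfix_mxP fixv aB; have -> : v + v *m star (enum B) a = \sum_(y in a |: B) v *m rG (tperm y a).
  by rewrite big_setU1 //= tperm1 repr_mx1 mulmx1 /star mulmx_sumr big_enum.
apply/rfix_mxP => s; rewrite inE => on_s.
rewrite mulmx_suml [RHS](reindex_inj (@perm_inj _ s)) /=.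
apply: eq_big => [y | y aBy]; first by rewrite perm_closed.
rewrite -mulmxA -repr_mxMT; set g := tperm (s y) a.
(* The factor [tperm y a * s * g] fixes [a] and lies in [Sym B], so it fixes [v] and only the last
   [g] remains. *)
have -> : (tperm y a * s = tperm y a * s * g * g)%g by rewrite /g -mulgA tperm2 mulg1.
rewrite repr_mxMT mulmxA fixv // inE; apply/subsetP => x; rewrite inE; apply: contraR => Bx.
rewrite /g !permM; case: (eqVneq x a) => [->|xa]; first by rewrite tpermR tpermL.
have aBx : x \notin a |: B by rewrite !inE negb_or xa.
have nx z : z \in a |: B -> z != x by move=> aBz; apply: contraNneq aBx => <-.
have -> : tperm y a x = x by rewrite tpermD ?nx ?setU11.
by rewrite (out_perm on_s aBx) tpermD ?nx ?setU11 ?perm_closed.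
Qed.

(* [s] lists the points of the [t] blocks chosen so far. *)
Definition adapted s W t :=
  [/\ uniq s, W != 0,
      forall g, g \in Sym [set x | x \notin s] -> (W *m rG g <= W)%MS
    & forall a, a \notin s -> W *m star s a = - t%:R *: W].

Lemma sub_eigen m (U : 'M[algC]_(m, d)) W X (z : algC) :
  (U <= W)%MS -> W *m X = z *: W -> U *m X = z *: U.
Proof. by move=> /submxP[D ->] WX; rewrite -mulmxA WX scalemxAr. Qed.

Lemma star_cat s1 s2 a : star (s1 ++ s2) a = star s1 a + star s2 a.
Proof. by rewrite /star big_cat. Qed.

(** The next block [B] is a largest set of remaining points whose fixed space meets [W]. Its star
    acts as -1 at every later point, while transpositions inside [B] act trivially. The last clause
    later identifies the size of the first block with [first_row]. *)
Lemma adapted_step s W t : (0 < d)%N -> adapted s W t -> (size s < n)%N ->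
  exists B W', [/\ (0 < #|B|)%N, (#|B| <= first_row rG)%N, (W' <= W)%MS,
    adapted (s ++ enum B) W' t.+1
  & (forall q a, (q < #|B|)%N ->
      W' *m star (s ++ take q (enum B)) (nth a (enum B) q) = (q%:R - t%:R) *: W')
  /\ forall C : {set _}, C \subset [set x | x \notin s] -> (W :&: rfix_mx rG (Sym C))%MS != 0 ->
       (#|C| <= #|B|)%N].
Proof.
move=> d_gt0 [us nzW stabW relW] ltsn; set A := [set x | x \notin s] in stabW *.
have [x0 sx0] : exists x, x \notin s.
  apply/existsP; rewrite -negb_forall; apply: contraL ltsn => /forallP all_s.
  rewrite -leqNgt -[n in (n <= _)%N]card_ord -(card_uniqP us).
  by apply/subset_leq_card/subsetP => x _; apply: all_s.
pose P B := (B \subset A) && ((W :&: rfix_mx rG (Sym B))%MS != 0).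
have P0 : P [set x0].
  rewrite /P sub1set inE sx0 /= Sym_card_le1 ?cards1 //.
  apply: contraNneq nzW => W0; rewrite -submx0 -W0 sub_capmx submx_refl.
  by apply/rfix_mxP => g /set1P->; rewrite repr_mx1 mulmx1.
case: (arg_maxnP (fun B : {set 'I_n} => #|B|) P0) => B /andP[BA nzB] maxB.
set W' := (W :&: rfix_mx rG (Sym B))%MS in nzB.
have sW' : (W' <= W)%MS by apply: capmxSl.
have fixW' : (W' <= rfix_mx rG (Sym B))%MS by apply: capmxSr.
have mB y : y \in B -> y \notin s by move/(subsetP BA); rewrite inE.
have relB a : a \notin s -> a \notin B -> W' *m star (enum B) a = - W'.
  move=> sa Ba; apply/eqP; rewrite -addr_eq0 addrC; apply/eqP.
  have fixu := symmetrize_fixed fixW' Ba.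
  (* If [u] were nonzero, [a |: B] would satisfy [P] and be larger than [B]. *)
  set u := W' + _ in fixu *; apply/eqP; apply: contraT => nzu.
  have : (#|a |: B| <= #|B|)%N.
    apply: maxB; rewrite /P subUset sub1set inE sa BA /=.
    apply: contraNneq nzu => capW0; rewrite -submx0 -capW0 sub_capmx fixu andbT.
    rewrite addmx_sub // /star mulmx_sumr big_enum summx_sub //= => y By.
    apply: submx_trans (submxMr _ sW') (stabW _ _); rewrite inE.
    apply: subset_trans (tperm_on y a) _; rewrite subUset !sub1set !inE sa andbT.
    exact: mB.
  by rewrite cardsU1 Ba add1n ltnn.
exists B, W'; split=> //.
- by have := maxB _ P0; rewrite /= cards1.
- rewrite card_le_first_row //; apply: contraNneq nzB => fix0.
  by rewrite /W' fix0 capmx0.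
- split=> //.
  + rewrite cat_uniq us enum_uniq andbT; apply/hasPn => y; rewrite mem_enum; exact: mB.
  + move=> g; rewrite inE => on_g.
    have gA : perm_on A g.
      by apply: subset_trans on_g _; apply/subsetP => x; rewrite !inE mem_cat negb_or => /andP[].
    rewrite sub_capmx (submx_trans (submxMr _ sW')) ?stabW ?inE //=.
    apply/rfix_mxP => h; rewrite inE => on_h; rewrite -mulmxA -repr_mxMT.
    (* The supports of [g] and [h] are disjoint. *)
    suff -> : (g * h = h * g)%g by rewrite repr_mxMT mulmxA (rfix_mxP _ fixW') // inE.
    apply/permP => x; rewrite !permM; have [Bx | nBx] := boolP (x \in B).
      by rewrite !(out_perm on_g) // inE mem_cat mem_enum ?(perm_closed _ on_h) Bx orbT.
    rewrite (out_perm on_h nBx) (out_perm on_h) //.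
    have [->//|gx] := eqVneq (g x) x.
    have : g x \in [set x | x \notin s ++ enum B].
      by rewrite (perm_closed _ on_g); apply: (subsetP on_g); rewrite inE.
    by rewrite inE mem_cat mem_enum negb_or => /andP[].
  + move=> a; rewrite mem_cat mem_enum negb_or => /andP[sa Ba].
    by rewrite star_cat mulmxDr (sub_eigen sW' (relW a sa)) relB // -[- W']scaleN1r -scalerDl -natr1 opprD.
split=> [q a ltq | C CA nzC]; last by apply: maxB; rewrite /P CA.
set b := nth a _ q.
have Bb : b \in B by rewrite -mem_enum mem_nth // -cardE.
rewrite star_cat mulmxDr (sub_eigen sW' (relW b (mB b Bb))) [LHS]addrC.
rewrite scalerDl; congr (_ + _); rewrite /star mulmx_sumr.
rewrite (eq_big_seq (fun=> W')) => [|y /mem_take]; last first.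
  rewrite mem_enum => By; apply: (rfix_mxP _ fixW'); rewrite inE.
  by apply: subset_trans (tperm_on y b) _; rewrite subUset !sub1set By.
by rewrite big_const_seq count_predT size_takel -?cardE 1?ltnW // iter_addr_0 scaler_nat.
Qed.

End Greedy.

(** * Joint eigenvectors of the Jucys-Murphy elements *)

Section ContentEigenvector.
Variables (n d : nat) (rG : mx_representation algC [set: 'S_n] d).
Hypothesis d_gt0 : (0 < d)%N.
Implicit Types (s : seq 'I_n) (W : 'M[algC]_d).

(** Iteration of [adapted_step]: nonempty blocks use up the remaining points, and relations found on
    [W] persist on its subspace [W']. *)
Lemma adapted_complete s W t : adapted rG s W t ->
  exists s' e W', [/\ (W' <= W)%MS, W' != 0, uniq (s ++ s') /\ size (s ++ s') = n,
    size e = size s' /\ contents (first_row rG) t e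
  & forall q a, (q < size s')%N ->
      W' *m star rG (s ++ take q s') (nth a s' q) = (nth 0 e q)%:~R *: W'].
Proof.
have [k] := ubnP (n - size s)%N; elim: k => // k IHk in s W t *.
move=> ltk adW; have [us nzW _ _] := adW.
have szs : (size s <= n)%N by rewrite -[n in (_ <= n)%N]card_ord -(card_uniqP us) max_card.
have [lts | ges] := ltnP (size s) n; last first.
  exists [::], [::], W; split=> //; last by split=> //; apply: contents_nil.
  by rewrite cats0 us; split=> //; apply/eqP; rewrite eqn_leq szs.
have [B [W1 [B_gt0 leB sW1 adW1 [relB _]]]] := adapted_step d_gt0 adW lts.
have [|s' [e [W' [sW' nzW' [us' szs'] [sze cont] rel]]]] := IHk _ _ _ _ adW1.
  by move: B_gt0 ltk lts; rewrite size_cat -cardE; move: #|B| (size s) => b m; lia.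
exists (enum B ++ s'), (content_row t #|B| ++ e), W'; split=> //.
- exact: submx_trans sW' sW1.
- by rewrite catA us'.
- split; last exact: contents_row.
  by rewrite !size_cat sze size_content_row cardE.
move=> q a; rewrite size_cat -cardE => ltq.
rewrite !nth_cat take_cat -cardE size_content_row.
have [ltqB | geqB] := ltnP q #|B|.
  by rewrite nth_content_row //; apply: sub_eigen sW' _; apply: relB.
by rewrite catA rel // ltn_subLR.
Qed.

(** Translation by the inverse of the permutation taking [q] to the [q]-th point of [s] turns the
    order of [s] into the natural order of ['I_n]. *)
Lemma star_id_eigen s W (e : seq int) : uniq s -> size s = n -> W != 0 ->
  (forall q a, (q < n)%N -> W *m star rG (take q s) (nth a s q) = (nth 0 e q)%:~R *: W) ->
  exists2 W' : 'M[algC]_d, W' != 0 & forall q : 'I_n,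
    W' *m (\sum_(i < n | (i < q)%N) rG (tperm i q)) = (nth 0 e q)%:~R *: W'.
Proof.
move=> us szs nzW rel.
pose f (q : 'I_n) := nth q s q.
have inj_f : injective f.
  move=> i j; rewrite /f (set_nth_default j) ?szs // => /eqP.
  by rewrite nth_uniq ?szs // => /eqP/val_inj.
pose g := perm inj_f; have gE q : g q = nth q s q by rewrite permE.
exists (W *m rG g^-1%g).
  by rewrite -mxrank_eq0 mxrankMfree ?mxrank_eq0 // row_free_unit repr_mx_unit ?inE.
move=> q; rewrite scalemxAl -(rel q q) ?ltn_ord // -!mulmxA; congr (_ *m _).
rewrite /star [in RHS](big_nth q) size_takel ?szs 1?ltnW // [in RHS]big_mkord.
rewrite (big_ord_widen n (fun i => rG (tperm (nth q (take q s) i) (nth q s q)))); last exact: ltnW.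
rewrite mulmx_suml mulmx_sumr; apply: eq_bigr => i ltiq.
rewrite -!repr_mxMT nth_take // -gE (set_nth_default i) ?szs // -gE -tpermJ conjgE.
by rewrite -!mulgA mulgV mulg1.
Qed.

(** The first step is made separately: it starts from the whole space, so its block has exactly
    [first_row rG] points. *)
Lemma jucys_murphy_eigenvector : (0 < n)%N -> exists (W : 'M[algC]_d) (e : seq int),
  [/\ W != 0, size e = (n - first_row rG)%N, contents (first_row rG) 1 e
  & forall q : 'I_n, W *m (\sum_(i < n | (i < q)%N) rG (tperm i q))
      = (nth 0 (content_row 0 (first_row rG) ++ e) q)%:~R *: W].
Proof.
move=> n_gt0.
have ad0 : adapted rG [::] 1%:M 0.
  split=> // [|g _|a _]; first by rewrite -mxrank_eq0 mxrank1 -lt0n.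
    exact: submx1.
  by rewrite /star big_nil mulmx0 oppr0 scale0r.
have [B [W1 [B_gt0 leB _ adW1 [relB maxB]]]] := adapted_step d_gt0 ad0 n_gt0.
have cardB : #|B| = first_row rG.
  apply/eqP; rewrite eqn_leq leB; have [C nzC <-] := first_row_attained rG d_gt0.
  apply: maxB; first by apply/subsetP => x _; rewrite inE.
  by apply: contraNneq nzC => capC; rewrite -submx0 -capC sub_capmx submx1 submx_refl.
have [s' [e [W [sW nzW [us szs] [sze cont] rel]]]] := adapted_complete adW1.
have relW q a : (q < n)%N ->
    W *m star rG (take q (enum B ++ s')) (nth a (enum B ++ s') q)
    = (nth 0 (content_row 0 (first_row rG) ++ e) q)%:~R *: W.
  move=> ltq; rewrite !nth_cat take_cat -cardE size_content_row -cardB.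
  have [ltqB | geqB] := ltnP q #|B|.
    by rewrite nth_content_row //; apply: sub_eigen sW _; apply: relB.
  by rewrite rel // ltn_subLR // cardE -size_cat szs.
have [W' nzW' relW'] := star_id_eigen us szs nzW relW.
exists W', e; split=> //.
by move: szs; rewrite size_cat -cardE sze -cardB; move: (size s') #|B| => x y; lia.
Qed.

End ContentEigenvector.

(** * Parametrization of the 4-cycles *)

Section FourCycles.
Variable n : nat.
Local Notation I := 'I_n.

(** Products act from left to right, so for distinct points this is the cycle from [q] to [i], [j],
    [l] and back. It is a monomial in the cube of the Jucys-Murphy element of [q]. *)
Definition cycle4 (x : I * I * I * I) : 'S_n :=
  let: (q, i, j, l) := x in (tperm i q * tperm j q * tperm l q)%g.

(* Each 4-cycle is written once, from its largest moved point [q]. *)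
Definition cycle4_dom : {set I * I * I * I} :=
  [set x : I * I * I * I | let: (q, i, j, l) := x in
    [&& (i < q)%N, (j < q)%N, (l < q)%N, j != i, l != i & l != j]].

Lemma cycle4E q i j l : (q, i, j, l) \in cycle4_dom ->
  [/\ cycle4 (q, i, j, l) q = i, cycle4 (q, i, j, l) i = j, cycle4 (q, i, j, l) j = l,
      cycle4 (q, i, j, l) l = q
    & forall y, y \notin [:: q; i; j; l] -> cycle4 (q, i, j, l) y = y].
Proof.
rewrite inE => /and5P[iq jq lq ji /andP[li lj]].
have ne (a b : I) : (a < b)%N -> (a == b) = false by move=> h; apply/negbTE; rewrite -val_eqE /= neq_ltn h.
have neqs := (ne _ _ iq, ne _ _ jq, ne _ _ lq, negPf ji, negPf li, negPf lj).
have neqs' := (eq_sym q i, eq_sym q j, eq_sym q l, eq_sym i j, eq_sym i l, eq_sym j l).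
split=> [| | | |y]; rewrite /cycle4 ?permM.
- by rewrite tpermR !tpermD // ?neqs' ?neqs.
- by rewrite tpermL tpermR tpermD // ?neqs' ?neqs.
- have -> : tperm i q j = j by rewrite tpermD // ?neqs' ?neqs.
  by rewrite tpermL tpermR.
- have -> : tperm i q l = l by rewrite tpermD // ?neqs' ?neqs.
  have -> : tperm j q l = l by rewrite tpermD // ?neqs' ?neqs.
  by rewrite tpermL.
rewrite !inE !negb_or => /and4P[yq yi yj yl].
by rewrite !tpermD // eq_sym.
Qed.

(** The cycle determines [q] as its largest moved point, then [i], [j], [l] as the successive images
    of [q]. *)
Lemma cycle4_inj : {in cycle4_dom &, injective cycle4}.
Proof.
move=> [[[q i] j] l] [[[q' i'] j'] l'] dx dx' eqs.
have [s1 s2 s3 s4 s5] := cycle4E dx; have [s1' s2' s3' s4' s5'] := cycle4E dx'.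
have [/and5P[iq jq lq ji /andP[li lj]] /and5P[iq' jq' lq' ji' /andP[li' lj']]] : 
  [&& (i < q)%N, (j < q)%N, (l < q)%N, j != i, (l != i) & l != j] /\
  [&& (i' < q')%N, (j' < q')%N, (l' < q')%N, j' != i', (l' != i') & l' != j'].
  by move: dx dx'; rewrite !inE.
rewrite -eqs in s1' s2' s3' s5'.
have qq : q = q'.
  apply/val_inj/eqP; rewrite eqn_leq; apply/andP; split.
    have : q \in [:: q'; i'; j'; l'].
      by apply: contraT => /s5'; rewrite s1 => e; rewrite e ltnn in iq.
    by rewrite !inE => /or4P[]/eqP-> //; apply: ltnW.
  have : q' \in [:: q; i; j; l].
    by apply: contraT => /s5; rewrite s1' => e; rewrite e ltnn in iq'.
  by rewrite !inE => /or4P[]/eqP-> //; apply: ltnW.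
move: (cycle4 (q, i, j, l)) s1 s2 s3 s1' s2' s3' => s s1 s2 s3 s1' s2' s3'.
have ii : i = i' by rewrite -s1 qq s1'.
have jj : j = j' by rewrite -s2 ii s2'.
have ll : l = l' by rewrite -s3 jj s3'.
by rewrite qq ii jj ll.
Qed.

Lemma c4_cycle4 : c4 n = cycle4 @: cycle4_dom.
Proof.
apply/setP=> s; rewrite inE; apply/existsP/imsetP => [[x /andP[/eqP px /forallP fix_s]] | [[[[q i] j] l] dx ->]].
  (* The cycle is read from the largest point [q] of its orbit. *)
  have [q xq maxq] := arg_maxnP (fun q : I => val q) (porbit_id s x).
  have pq : porbit s q = porbit s x by apply/eqP; rewrite eq_porbit_mem.
  have tq := uniq_traject_porbit s q; have mq := porbit_traject s q; have iq := iter_porbit s q.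
  rewrite pq px /= in tq mq iq.
  have lt_q y : y \in porbit s x -> y != q -> (y < q)%N.
    by move=> /maxq /= le_yq ne_yq; rewrite ltn_neqAle le_yq andbT.
  move: tq; rewrite !inE !negb_or => /and4P[/and3P[n1 n2 n3] /andP[n4 n5] n6 _].
  have mem k : (k < 4)%N -> iter k s q \in porbit s x.
    by move=> _; rewrite -pq -permX mem_porbit.
  have dx : (q, s q, s (s q), s (s (s q))) \in cycle4_dom.
    rewrite inE !lt_q ?(mem 1%N) ?(mem 2%N) ?(mem 3%N) // 1?eq_sym ?n1 ?n2 ?n3 //=.
    by rewrite !(eq_sym _ (s q)) n4 n5 eq_sym n6.
  exists (q, s q, s (s q), s (s (s q))) => //.
  have [s1 s2 s3 s4 s5] := cycle4E dx.
  apply/permP => y; have [yt | nyt] := boolP (y \in [:: q; s q; s (s q); s (s (s q))]).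
    by move: yt; rewrite !inE => /or4P[]/eqP->; rewrite ?s1 ?s2 ?s3 ?s4.
  rewrite s5 //; apply/eqP/(implyP (fix_s y)).
  by rewrite mq.
have [s1 s2 s3 s4 s5] := cycle4E dx; exists q; clear s; set s := cycle4 _ in s1 s2 s3 s4 s5 *.
have porb : porbit s q = [set y in [:: q; i; j; l]].
  apply/eqP; rewrite eqEsubset; apply/andP; split; apply/subsetP => y.
    case/porbitP => k ->; rewrite inE; elim: k => [|k]; first by rewrite expg0 perm1 !inE eqxx.
    rewrite expgSr permM !inE => /or4P[]/eqP->; rewrite ?s1 ?s2 ?s3 ?s4 eqxx ?orbT //.
  rewrite inE -s3 -s2 -s1 !inE => /or4P[]/eqP->; first exact: porbit_id.
  - exact: (mem_porbit s 1).
  - by have := mem_porbit s 2 q; rewrite permX.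
  - by have := mem_porbit s 3 q; rewrite permX.
rewrite porb; apply/andP; split; last by apply/forallP => y; apply/implyP; rewrite inE => /s5->.
rewrite cardsE; apply/eqP/(@card_uniqP _ [:: q; i; j; l]).
move: dx; rewrite inE /= !inE !negb_or => /and5P[iq jq lq ji /andP[li lj]].
by rewrite (eq_sym i j) (eq_sym i l) (eq_sym j l) ji li lj -!(inj_eq val_inj) !gtn_eqF.
Qed.

End FourCycles.

(** * The class sum in terms of the Jucys-Murphy elements *)

Section JM.
Variables (n d : nat) (rG : mx_representation algC [set: 'S_n] d).
Local Notation I := 'I_n.

Definition jucys_murphy (q : I) := \sum_(i : I | (i < q)%N) rG (tperm i q).
Local Notation X := jucys_murphy.

Lemma sum_c4_cycle4 :
  \sum_(s in c4 n) rG s =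
  \sum_(q : I) \sum_(i : I | (i < q)%N) \sum_(j : I | (j < q)%N && (j != i))
    \sum_(l : I | [&& (l < q)%N, l != i & l != j]) rG (cycle4 (q, i, j, l)).
Proof.
rewrite c4_cycle4 big_imset /=; last exact: cycle4_inj.
rewrite !pair_big_dep /=.
by apply: eq_big => [[[[q i] j] l]|[[[q i] j] l] _] //=; rewrite inE -!andbA; do !bool_congr.
Qed.

Lemma card_ord_lt (q : I) : #|[pred i : I | (i < q)%N]| = q.
Proof.
rewrite -sum1_card; rewrite -(big_ord_widen n (fun=> 1%N)) ?sum1_card ?card_ord //.
exact: ltnW.
Qed.

Lemma card_ord_gt (i : I) : #|[pred q : I | (i < q)%N]| = (n - i.+1)%N.
Proof.
have := cardC [pred q : I | (q < i.+1)%N]; rewrite card_ord.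
rewrite -[#|[pred q : I | (q < i.+1)%N]|]sum1_card -(big_ord_widen n (fun=> 1%N)) ?sum1_card ?card_ord //.
move=> Hn; apply: (@addnI i.+1); rewrite subnKC //; apply: etrans _ Hn.
by congr addn; apply: eq_card => q; rewrite !inE -leqNgt.
Qed.

(** A transposition with larger point [i] occurs once for each order of its two points and each of
    the [n - i.+1] values of [q] above [i]. *)
Lemma sum_tperm_lt :
  \sum_(q : I) \sum_(i : I | (i < q)%N) \sum_(j : I | (j < q)%N && (j != i)) rG (tperm j i)
  = \sum_(i : I) (n - i.+1)%:R *: (X i + X i).
Proof.
have sumX (F : I -> 'M[algC]_d) : \sum_(q : I) \sum_(i : I | (i < q)%N) F i = \sum_(i : I) (n - i.+1)%:R *: F i.
  rewrite (exchange_big_dep xpredT) //=; apply: eq_bigr => i _.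
  by rewrite sumr_const card_ord_gt scaler_nat.
under [RHS]eq_bigr do rewrite scalerDr.
rewrite big_split /= -sumX -big_split /=; apply: eq_bigr => q _.
have -> : \sum_(i : I | (i < q)%N) \sum_(j : I | (j < q)%N && (j != i)) rG (tperm j i)
  = \sum_(i : I | (i < q)%N) X i
    + \sum_(i : I | (i < q)%N) \sum_(j : I | (j < q)%N && (i < j)%N) rG (tperm i j).
  rewrite -big_split /=; apply: eq_bigr => i ltiq; rewrite (bigID (fun j : I => (j < i)%N)) /=.
  congr (_ + _).
    apply: eq_bigl => j; rewrite -(inj_eq val_inj) /=; lia.
  apply: eq_big => [j|j _]; last by rewrite tpermC.
  rewrite -(inj_eq val_inj) /=; lia.
congr (_ + _); rewrite (exchange_big_dep (fun j : I => (j < q)%N)) /=; last by move=> i j _ /andP[].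
apply: eq_bigr => j ltjq; apply: eq_bigl => i; lia.
Qed.

(** In the product of the transpositions of [q] with [i], [j], [l], the case [j = i] leaves
    [tperm l q], the case [l = i] leaves [tperm j i], the case [l = j] leaves [tperm i q], and
    distinct points give a 4-cycle. The first and third cases contribute [q] and [q - 1] copies of
    [X q]. *)
Lemma jucys_murphy_cube (q : I) :
  X q *m X q *m X q = (q%:R + q%:R - 1) *: X q
   + \sum_(i : I | (i < q)%N) \sum_(j : I | (j < q)%N && (j != i)) rG (tperm j i)
   + \sum_(i : I | (i < q)%N) \sum_(j : I | (j < q)%N && (j != i))
    \sum_(l : I | [&& (l < q)%N, l != i & l != j]) rG (cycle4 (q, i, j, l)).
Proof.
have -> : X q *m X q *m X q = \sum_(i : I | (i < q)%N) \sum_(j : I | (j < q)%N)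
    \sum_(l : I | (l < q)%N) rG (cycle4 (q, i, j, l)).
  have Xl (A : 'M[algC]_d) : X q *m A = \sum_(i : I | (i < q)%N) rG (tperm i q) *m A by exact: mulmx_suml.
  have Xr (A : 'M[algC]_d) : A *m X q = \sum_(i : I | (i < q)%N) A *m rG (tperm i q) by exact: mulmx_sumr.
  rewrite -mulmxA Xl; apply: eq_bigr => i _.
  rewrite Xl mulmx_sumr; apply: eq_bigr => j _.
  by rewrite mulmxA Xr; apply: eq_bigr => l _; rewrite !repr_mxMT.
have splitl (i j : I) : (i < q)%N -> (j < q)%N -> j != i ->
  \sum_(l : I | (l < q)%N) rG (cycle4 (q, i, j, l)) =
    rG (tperm j i) + rG (tperm i q) + \sum_(l : I | [&& (l < q)%N, l != i & l != j]) rG (cycle4 (q, i, j, l)).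
  move=> iq jq ji; rewrite (bigD1 i) //= (bigD1 j) ?jq //= addrA; congr (_ + _ + _).
  - have jE : tperm i q j = j.
      by rewrite tpermD 1?eq_sym // -(inj_eq val_inj) neq_ltn jq.
    have <- : tperm (tperm i q j) (tperm i q q) = tperm j i by rewrite jE tpermR.
    by rewrite -tpermJ conjgE tpermV mulgA.
  - by rewrite -mulgA tperm2 mulg1.
  - by apply: eq_bigl => l; rewrite andbA.
have splitj (i : I) : (i < q)%N -> \sum_(j : I | (j < q)%N) \sum_(l : I | (l < q)%N) rG (cycle4 (q, i, j, l))
   = X q + (q.-1)%:R *: rG (tperm i q)
     + \sum_(j : I | (j < q)%N && (j != i)) rG (tperm j i)
     + \sum_(j : I | (j < q)%N && (j != i))
        \sum_(l : I | [&& (l < q)%N, l != i & l != j]) rG (cycle4 (q, i, j, l)).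
  move=> iq; rewrite (bigD1 i) //= -!addrA; congr (_ + _).
    by apply: eq_bigr => l _; rewrite tperm2 mul1g.
  have -> : q.-1%:R *: rG (tperm i q) = \sum_(j : I | (j < q)%N && (j != i)) rG (tperm i q).
    rewrite sumr_const scaler_nat; congr (_ *+ _).
    have Hq := card_ord_lt q; rewrite (cardD1 i) inE iq add1n in Hq.
    apply: etrans (congr1 predn (esym Hq)) _.
    by apply: eq_card => j; rewrite /in_mem /= andbC.
  rewrite addrCA addrA -!big_split /=; apply: eq_bigr => j /andP[jq ji]; exact: splitl.
rewrite (eq_bigr _ splitj) !big_split /=; congr (_ + _ + _).
rewrite -scaler_sumr -/(X q) sumr_const card_ord_lt -scaler_nat -scalerDl.
(* For [q = 0] the truncated [q.-1] differs from [q - 1], but [X q] is then an empty sum. *)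
case: (posnP q) => [q0 | q_gt0].
  by rewrite /X big_pred0 ?scaler0 // => i; rewrite q0.
by congr (_ *: _); rewrite -addrA; congr (_ + _); rewrite -[in RHS](prednK q_gt0) -natr1 addrK.
Qed.

(** The coefficient of [X q] is [(2 q - 1) + 2 (n - q - 1) = 2 n - 3], independently of [q]. *)
Lemma sum_jucys_murphy_cube :
  \sum_q X q *m X q *m X q = \sum_(s in c4 n) rG s + (2 * n%:R - 3) *: \sum_q X q.
Proof.
under eq_bigr do rewrite jucys_murphy_cube.
rewrite !big_split /= -sum_c4_cycle4 addrC; congr (_ + _).
rewrite sum_tperm_lt -big_split /= scaler_sumr; apply: eq_bigr => q _.
rewrite scalerDr -scalerDl -scalerDl natrB ?ltn_ord //; congr (_ *: _); rewrite -natr1; ring.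
Qed.

Lemma c4_eigen (W : 'M[algC]_d) (e : I -> int) :
  (forall q, W *m X q = (e q)%:~R *: W) ->
  W *m (\sum_(s in c4 n) rG s) =
    (\sum_q (e q ^+ 3 - (2 * n%:Z - 3) * e q))%:~R *: W.
Proof.
move=> We; rewrite (canRL (addrK _) (esym sum_jucys_murphy_cube)) mulmxBr -scalemxAr !mulmx_sumr.
rewrite (eq_bigr (fun q => (e q ^+ 3)%:~R *: W)) => [|q _]; last first.
  by rewrite !mulmxA !We -!scalemxAl !We -!scalemxAl We !scalerA -!rmorphM !exprS expr0 mulr1 mulrA.
rewrite (eq_bigr _ (fun q _ => We q)) -!scaler_suml scalerA -scalerBl; congr (_ *: _).
rewrite sumrB -mulr_sumr rmorphB rmorphM rmorphB rmorphM /= !rmorph_sum /=.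
by [].
Qed.

End JM.

(** * Eigenvalues of the class sum and factorizations into 4-cycles *)

Section Walks.
Variable n : nat.
Local Notation G := [set: 'S_n]%G.
Implicit Types (s x y : 'S_n) (i : Iirr G).

Lemma c4J s x : (s ^ x \in c4 n)%g = (s \in c4 n).
Proof.
suff imp t z : t \in c4 n -> (t ^ z \in c4 n)%g.
  by apply/idP/idP; [move/(imp _ x^-1%g); rewrite conjgK | apply: imp].
rewrite !inE => /existsP[q /andP[cq /forallP fix_t]].
have orbJ : porbit (t ^ z)%g (z q) = z @: porbit t q.
  apply/setP => y; apply/porbitP/imsetP => [[k ->] | [_ /porbitP[k ->] ->]].
    by exists ((t ^+ k)%g q); rewrite ?mem_porbit // -conjXg permJ.
  by exists k; rewrite -conjXg permJ.
apply/existsP; exists (z q); rewrite orbJ card_imset ?cq /=; last exact: perm_inj.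
apply/forallP => y; rewrite -[y](permKV z) mem_imset ?permJ; last exact: perm_inj.
by apply/implyP => /(implyP (fix_t _))/eqP->.
Qed.

Lemma c4V s : (s^-1 \in c4 n)%g = (s \in c4 n).
Proof.
rewrite !inE; apply: eq_existsb => x; rewrite porbitV; congr (_ && _).
by apply: eq_forallb => y; rewrite (can2_eq (permKV s) (permK s)) eq_sym.
Qed.

(* By [sum_jucys_murphy_cube], the share of a cell of content [x] in the eigenvalue of the class
   sum. *)
Definition c4_poly (x : int) : int := x ^+ 3 - (2 * n%:Z - 3) * x.

(** The class sum is central, hence scalar by Schur's lemma; the joint eigenvector of the
    Jucys-Murphy elements reveals the scalar, an integer. *)
Lemma c4_scalar i : (0 < n)%N -> exists z e,
  [/\ \sum_(s in c4 n) 'Chi_i s = (z%:~R)%:M,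
      size e = (n - first_row 'Chi_i)%N, contents (first_row 'Chi_i) 1 e
    & z = \sum_(x <- content_row 0 (first_row 'Chi_i) ++ e) c4_poly x].
Proof.
move=> n_gt0; have irr_i := socle_irr (socle_of_Iirr i).
have [W [e [nzW sze cont We]]] := jucys_murphy_eigenvector 'Chi_i (deg_gt0 i) n_gt0.
have cent : centgmx 'Chi_i (\sum_(s in c4 n) 'Chi_i s).
  apply/centgmxP => x _; rewrite mulmx_suml mulmx_sumr (reindex_inj (conjg_inj x^-1%g)) /=.
  apply: eq_big => s; first by rewrite c4J.
  by move=> _; rewrite -!repr_mxMT conjgE invgK mulgA mulgKV.
have /is_scalar_mxP[a scal] := mx_abs_irr_cent_scalar (groupC irr_i) cent.
have := c4_eigen We; rewrite [X in _ *m X](_ : _ = a%:M) ?mul_mx_scalar => [/eqP|]; last exact: scal.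
rewrite -subr_eq0 -scalerBl scaler_eq0 (negPf nzW) orbF subr_eq0 => /eqP aE.
exists (\sum_(x <- content_row 0 (first_row 'Chi_i) ++ e) c4_poly x), e; split=> //.
rewrite scal aE (big_nth 0) size_cat size_content_row sze subnKC ?first_row_le //.
by rewrite big_mkord.
Qed.

(** Number of factorizations of [x] into [k] 4-cycles, the integer numerator of the convolution
    power. *)
Fixpoint walks k x : nat :=
  if k is k'.+1 then (\sum_(y in c4 n) walks k' (y^-1 * x)%g)%N else x == 1%g.

Lemma walksD k l x : walks (k + l) x = (\sum_y walks k y * walks l (y^-1 * x)%g)%N.
Proof.
elim: k x => [|k IHk] x.
  rewrite (bigD1 1%g) //= eqxx mul1n invg1 mul1g big1 ?addn0 // => y /negPf->.
  by rewrite mul0n.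
rewrite addSn /= (eq_bigr _ (fun y _ => IHk _)).
under [RHS]eq_bigr do rewrite big_distrl /=.
rewrite [RHS]exchange_big /=; apply: eq_bigr => z _.
rewrite [RHS](reindex_inj (mulgI z)) /=; apply: eq_bigr => y _.
by rewrite mulKg invMg !mulgA.
Qed.

Lemma walks1 x : walks 1 x = (x \in c4 n).
Proof.
rewrite /=; case: (boolP (x \in c4 n)) => cx.
  rewrite (bigD1 x) //= mulVg eqxx big1 // => y /andP[_ nyx].
  by rewrite -eq_mulVg1 (negPf nyx).
rewrite big1 // => y cy; rewrite -eq_mulVg1; case: eqP => // yx.
by rewrite -yx cy in cx.
Qed.

(** Inversion reverses a factorization, so the first factor is peeled off on one side and the last
    on the other. *)
Lemma walksV k x : walks k x^-1%g = walks k x.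
Proof.
elim: k x => [|k IHk] x; first by rewrite /= invg_eq1.
rewrite -[in RHS]addn1 walksD /= [RHS](reindex_inj (mulgI x)) /=.
rewrite [RHS](eq_bigr (fun z => walks k (x * z)%g * (z \in c4 n)))%N; last first.
  by move=> z _; rewrite [(\sum_(_ in _) _)%N](walks1 _) invMg mulgKV c4V.
rewrite big_mkcond /=; apply: eq_bigr => z _; rewrite -IHk invMg !invgK.
by case: (z \in c4 n); rewrite ?muln1 ?muln0.
Qed.

Lemma sum_walks k : (\sum_x walks k x = #|c4 n| ^ k)%N.
Proof.
elim: k => [|k IHk] /=.
  by rewrite (bigD1 1%g) //= eqxx big1 // => x /negPf->.
rewrite exchange_big /= expnS -sum_nat_const; apply: eq_bigr => y _.
by rewrite -IHk [RHS](reindex_inj (mulgI y^-1%g)).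
Qed.

Lemma walks_repr d (rG : mx_representation algC G d) z k :
  \sum_(s in c4 n) rG s = z%:M ->
  \sum_x (walks k x)%:R *: rG x = (z ^+ k)%:M.
Proof.
move=> scal; elim: k => [|k IHk] /=.
  rewrite (bigD1 1%g) //= eqxx scale1r repr_mx1 big1 ?addr0 // => x /negPf->.
  by rewrite scale0r.
rewrite exprS scalar_mxM -IHk -scal mulmx_suml.
under eq_bigr do rewrite natr_sum scaler_suml.
rewrite exchange_big /=; apply: eq_bigr => y _; rewrite mulmx_sumr (reindex_inj (mulgI y)) /=.
by apply: eq_bigr => x _; rewrite mulKg repr_mxMT scalemxAr.
Qed.

(** Fourier inversion at the identity, with the regular character isolating the value there. *)
Lemma walks_return (z : Iirr G -> int) k :
  (forall i, \sum_(s in c4 n) 'Chi_i s = ((z i)%:~R)%:M) ->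
  (n`! * walks k 1%g)%:Z = \sum_i (deg i ^ 2)%:Z * z i ^+ k.
Proof.
move=> scal; apply: (@intr_inj algC); rewrite rmorph_sum /=.
transitivity (\sum_x (walks k x)%:R * \sum_i (deg i)%:R * 'chi[G]_i x).
  rewrite (bigD1 1%g) //= sum_deg_irr eqxx big1 ?addr0 => [|x /negPf nx]; last first.
    by rewrite sum_deg_irr nx mulr0.
  by rewrite mulnC -natrM.
transitivity (\sum_x \sum_i (walks k x)%:R * ((deg i)%:R * 'chi[G]_i x)).
  by apply: eq_bigr => x _; apply: mulr_sumr.
rewrite exchange_big /=; apply: eq_bigr => i _.
transitivity ((deg i)%:R * \tr (\sum_x (walks k x)%:R *: 'Chi_i x)).
  rewrite [\tr _]raddf_sum /= mulr_sumr; apply: eq_bigr => x _.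
  by rewrite mxtraceZ mxtrace_Chi mulrCA.
rewrite (walks_repr k (scal i)) mxtrace_scalar rmorphM rmorphXn /=.
by rewrite mulrnAr -mulrnAl -mulr_natr -natrM.
Qed.

(** Plancherel: by invariance under inversion, the inner product of two walks is a return count of
    length [k + l]. *)
Lemma sum_walks_mul (z : Iirr G -> int) k l :
  (forall i, \sum_(s in c4 n) 'Chi_i s = ((z i)%:~R)%:M) ->
  (n`! * \sum_x walks k x * walks l x)%:Z = \sum_i (deg i ^ 2)%:Z * (z i ^+ k * z i ^+ l).
Proof.
move=> scal; under [RHS]eq_bigr do rewrite -exprD.
rewrite -walks_return // walksD; congr (Posz (muln _ _)).
by apply: eq_bigr => y _; rewrite mulg1 walksV.
Qed.

Lemma c4_scalar0 (z : int) : \sum_(s in c4 n) 'Chi_(0 : Iirr G) s = (z%:~R)%:M -> z = #|c4 n|.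
Proof.
move=> scal; apply: (@intr_inj algC); have := congr1 mxtrace scal.
rewrite mxtrace_scalar raddf_sum /= (eq_bigr (fun=> 1)) => [|s _]; last first.
  by rewrite mxtrace_Chi irr0 cfun1E inE.
by rewrite sumr_const -[irr_degree _]/(deg (0 : Iirr G)) deg0 mulr1n => <-.
Qed.

End Walks.

(** * Upper bounds for the eigenvalues of the class sum *)

Section Bounds.
Variable n : nat.

Lemma content_rowS t l : content_row t l.+1 = rcons (content_row t l) (l%:Z - t%:Z).
Proof. by rewrite /content_row -addn1 iotaD map_cat cats1. Qed.

Lemma c4_poly_le (c t : nat) : (11 <= n)%N ->
  4 * c4_poly n (c%:Z - t%:Z) <= 4 * c%:Z ^+ 3 + n%:Z ^+ 2.
Proof.
move=> le11n; rewrite /c4_poly.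
have N11 : 11 <= n%:Z by lia.
have [x_ge0 | x_lt0] := lerP 0 (c%:Z - t%:Z).
  have le_xc : c%:Z - t%:Z <= c%:Z by lia.
  have : (c%:Z - t%:Z) ^+ 3 <= c%:Z ^+ 3 by rewrite lerXn2r ?nnegrE //; lia.
  have : 0 <= (2 * n%:Z - 3) * (c%:Z - t%:Z) by apply: mulr_ge0 => //; lia.
  have := sqr_ge0 (n%:Z); lia.
have c3 : 0 <= c%:Z ^+ 3 by apply: exprn_ge0; lia.
suff : 4 * ((c%:Z - t%:Z) ^+ 3 - (2 * n%:Z - 3) * (c%:Z - t%:Z)) <= n%:Z ^+ 2 by lia.
have [y yE] : exists y : nat, c%:Z - t%:Z = - (y.+1)%:Z by exists (t - c).-1; lia.
rewrite yE !exprS expr0 !mulr1.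
have [-> | -> | y3] : [\/ y = 0%N, y = 1%N | (2 <= y)%N] by case: (y) => [|[|k]]; constructor.
- nia.
(* At content -2 the claim is [0 <= n^2 - 16 n + 56], true for [n >= 11] but false at [n = 10]. *)
- nia.
move: (n%:Z) N11 => N N11; have Y3 : 3 <= y.+1%:Z by lia.
move: (y.+1%:Z) Y3 => Y Y3.
(* The square gives [8 N Y <= N^2 + 16 Y^2], and what is left is [-4 Y (Y - 1) (Y - 3) <= 0]. *)
have h1 : 0 <= (N - 4 * Y) * (N - 4 * Y) by rewrite -expr2 sqr_ge0.
have h2 : 0 <= Y * ((Y - 1) * (Y - 3)) by apply: mulr_ge0; [lia | apply: mulr_ge0; lia].
nia.
Qed.

(** [c4_poly_le] is summed along the row, where four times the sum of the cubes is
    [(l (l - 1))^2]. *)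
Lemma sum_content_row_le t l : (11 <= n)%N ->
  4 * \sum_(x <- content_row t l) c4_poly n x <= (l%:Z * (l%:Z - 1)) ^+ 2 + l%:Z * n%:Z ^+ 2.
Proof.
move=> le11n; elim: l => [|l IHl]; first by rewrite big_nil !mul0r expr0n mulr0 addr0.
rewrite content_rowS big_rcons /= mulrDr.
have := lerD (c4_poly_le l t le11n) IHl; rewrite addrC => /le_trans; apply.
rewrite le_eqVlt; apply/orP; left; apply/eqP; rewrite -natr1; ring.
Qed.

Lemma sum_content_row0 l :
  4 * \sum_(x <- content_row 0 l) c4_poly n x =
  (l%:Z * (l%:Z - 1)) ^+ 2 - 2 * (2 * n%:Z - 3) * (l%:Z * (l%:Z - 1)).
Proof.
elim: l => [|l IHl]; first by rewrite big_nil !mul0r expr0n mulr0 subrr mulr0.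
rewrite content_rowS big_rcons /= mulrDr IHl /c4_poly -natr1; ring.
Qed.

(** No row has more cells than all rows together; below a long first row this improves on the bound
    by [first_row]. *)
Lemma contents_widen M M' t e : contents M t e -> (size e <= M')%N -> contents M' t e.
Proof.
elim=> {t e} [t|t l e _ _ IH]; first by move=> _; apply: contents_nil.
rewrite size_cat size_content_row => le_M'.
by apply: contents_row; [exact: leq_trans (leq_addr _ _) le_M' | apply: IH; exact: leq_trans (leq_addl _ _) le_M'].
Qed.

Lemma sum_contents_le M t e : (11 <= n)%N -> contents M t e ->
  4 * \sum_(x <- e) c4_poly n x <= (size e)%:Z * (M%:Z ^+ 3 + n%:Z ^+ 2).
Proof.
move=> le11n; elim=> {t e} [t|t l e le_lM _ IH]; first by rewrite big_nil mulr0 mul0r.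
rewrite big_cat /= mulrDr size_cat size_content_row PoszD [leRHS]mulrDl.
apply: lerD; last exact: IH.
apply: le_trans (sum_content_row_le t l le11n) _.
rewrite [leRHS]mulrDr lerD2r.
have L0 : 0 <= l%:Z by [].
have LM : l%:Z <= M%:Z by [].
have : l%:Z ^+ 3 <= M%:Z ^+ 3 by rewrite lerXn2r ?nnegrE.
move: (M%:Z ^+ 3) => M3; move: (l) => [|k] //=; first by rewrite !mul0r expr0n.
move=> h; rewrite expr2 -mulrA ler_wpM2l //; apply: le_trans h.
rewrite !exprS expr0 mulr1; nia.
Qed.

(** The first bound evaluates the first row exactly and serves for small [n - m]; the second
    estimates every row by the length [m]. *)
Lemma c4_scalar_bounds (i : Iirr [set: 'S_n]) (z : int) (m : nat) :
  (11 <= n)%N -> m = first_row 'Chi_i ->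
  \sum_(s in c4 n) 'Chi_i s = (z%:~R)%:M ->
  4 * z <= (m%:Z * (m%:Z - 1)) ^+ 2 - 2 * (2 * n%:Z - 3) * (m%:Z * (m%:Z - 1))
           + (n - m)%:Z * ((n - m)%:Z ^+ 3 + n%:Z ^+ 2)
  /\ 4 * z <= n%:Z * (m%:Z ^+ 3 + n%:Z ^+ 2).
Proof.
move=> le11n -> scal.
have [z' [e [scal' sze cont z'E]]] := c4_scalar i (leq_trans (isT : (0 < 11)%N) le11n).
have -> : z = z'.
  have : (z%:~R)%:M = (z'%:~R)%:M :> 'M[algC]_(deg i) by rewrite -scal -scal'.
  have := deg_gt0 i; case: (deg i) => // d _ /matrixP/(_ 0 0).
  by rewrite !mxE eqxx !mulr1n => /intr_inj.
rewrite z'E big_cat /= mulrDr; split.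
  rewrite sum_content_row0 lerD2l -sze; apply: sum_contents_le le11n _.
  exact: contents_widen cont _.
have nE : n%:Z = (first_row 'Chi_i)%:Z + (size e)%:Z.
  by rewrite sze -PoszD subnKC ?first_row_le.
rewrite [X in _ <= X * _]nE [leRHS]mulrDl.
apply: lerD; last exact: sum_contents_le cont.
have cont0 : contents (first_row 'Chi_i) 0 (content_row 0 (first_row 'Chi_i)).
  by rewrite -[content_row _ _]cats0; apply: contents_row; last exact: contents_nil.
by have := sum_contents_le le11n cont0; rewrite size_content_row.
Qed.

(* Evaluation of the class sum on the trivial module. *)
Lemma card_c4 : (0 < n)%N -> 4 * (#|c4 n|)%:Z =
  n%:Z * (n%:Z - 1) * (n%:Z - 2) * (n%:Z - 3).
Proof.
move=> n_gt0; have [z [e [scal sze _ zE]]] := c4_scalar 0 n_gt0.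
have fr0 : first_row 'Chi_(0 : Iirr [set: 'S_n]%G) = n.
  apply/eqP; rewrite eqn_leq first_row_le /= -[n in (n <= _)%N]card_ord -cardsT.
  apply: card_le_first_row; have d_gt0 := deg_gt0 (0 : Iirr [set: 'S_n]%G).
  have : (0 < \rank (rfix_mx 'Chi_(0 : Iirr [set: 'S_n]%G) [set: 'S_n]%G))%N.
    rewrite lt0n; apply: contraTneq isT => rk0.
    have := rank_rfix_mx 'Chi_(0 : Iirr [set: 'S_n]%G) (subxx _); rewrite rk0 muln0.
    rewrite (eq_bigr (fun=> 1)) => [|s _]; last by rewrite mxtrace_Chi irr0 cfun1E inE.
    by rewrite sumr_const => /eqP; rewrite pnatr_eq0 -leqn0 leqNgt cardG_gt0.
  rewrite lt0n mxrank_eq0; apply: contraNneq => fix0; rewrite -submx0 -fix0.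
  exact/rfix_mxS/subsetT.
have e0 : e = [::] by apply/size0nil; rewrite sze fr0 subnn.
rewrite -(c4_scalar0 scal) zE fr0 e0 cats0 sum_content_row0; ring.
Qed.

End Bounds.

(* Otherwise terms annotated with type [R] would be read with the operations of Stdlib. *)
Bind Scope ring_scope with R.
#[local] Arguments exp _ : clear scopes.
#[local] Arguments ln _ : clear scopes.

(** * Limits of real sequences and the exponential series *)

Definition exp_partial (K : nat) (y : R) : R := \sum_(0 <= k < K.+1) y ^+ k / (k`!)%:R.

Lemma cv_exp_partial (y : R) : Un_cv (exp_partial ^~ y) (exp y).
Proof.
have := proj2_sig (exist_exp y); rewrite -/(exp y) /exp_in /infinite_sum => cv eps /cv[N HN].
exists N => k /HN; rewrite sum_f_R0E /exp_partial.
suff -> : \sum_(0 <= j < k.+1) Rmult (Rinv (INR (Factorial.fact j))) (pow y j) = \sum_(0 <= j < k.+1) y ^+ j / (j`!)%:R by [].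
by apply: eq_bigr => j _; rewrite INRE RpowE factE; exact: mulrC.
Qed.

Lemma cv_const (c : R) : Un_cv (fun=> c) c.
Proof. by move=> eps eps_gt0; exists 0%N => k _; rewrite /Rdist Rminus_diag Rabs_R0. Qed.

Lemma cvM u v (a b : R) : Un_cv u a -> Un_cv v b -> Un_cv (fun k => u k * v k) (a * b).
Proof. exact: CV_mult. Qed.

Lemma cv_sum (I : finType) (u : I -> nat -> R) (l : I -> R) :
  (forall i, Un_cv (u i) (l i)) -> Un_cv (fun k => \sum_i u i k) (\sum_i l i).
Proof.
move=> cv; elim: (index_enum I) => [|i r IH].
  by rewrite big_nil => eps eps_gt0; exists 0%N => k _; rewrite big_nil /Rdist Rminus_diag Rabs_R0.
rewrite big_cons => eps eps_gt0; have [N HN] := CV_plus _ _ _ _ (cv i) IH eps eps_gt0.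
by exists N => k /HN; rewrite big_cons.
Qed.

Lemma cv_ext (u v : nat -> R) l : u =1 v -> Un_cv u l -> Un_cv v l.
Proof. by move=> uv cu eps /cu[N HN]; exists N => k /HN; rewrite uv. Qed.

(** * Plancherel formula for the heat kernel *)

Section Fourier.
Variable n : nat.
Hypothesis le11n : (11 <= n)%N.
Local Notation G := [set: 'S_n]%G.
Local Notation A := ((#|c4 n|)%:R : R).

Lemma card_c4_gt0 : (0 < #|c4 n|)%N.
Proof.
have := card_c4 (leq_trans (isT : (0 < 11)%N) le11n).
case: (#|c4 n|) => // /eqP; rewrite mulr0 eq_sym !mulf_eq0; lia.
Qed.

Lemma A_neq0 : A != 0. Proof. by rewrite pnatr_eq0 -lt0n card_c4_gt0. Qed.

Lemma convpowE k x : convpow (@q_c4 n) k x = (walks k x)%:R / A ^+ k.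
Proof.
elim: k x => [|k IHk] x /=; first by rewrite /delta1 expr0 divr1; case: eqP.
rewrite /conv /sumS -[LHS]/(\sum_y q_c4 y * convpow (@q_c4 n) k (y^-1 * x)%g).
rewrite natr_sum mulr_suml [RHS]big_mkcond /=; apply: eq_bigr => y _.
rewrite IHk /q_c4; case: ifP => _; last exact: mul0r.
by rewrite INRE exprS invfM [RHS]mulrCA.
Qed.

Variable t : R.
Hypothesis t_ge0 : 0 <= t.

(** The factor [exp (- t)] of the heat kernel stays outside until [dist2_heat]. *)
Definition heat_term (x : 'S_n) (k : nat) : R := t ^+ k / (k`!)%:R * ((walks k x)%:R / A ^+ k).

Lemma heat_term_le x k : 0 <= heat_term x k <= t ^+ k / (k`!)%:R.
Proof.
have t_k : 0 <= t ^+ k / (k`!)%:R by rewrite divr_ge0 ?exprn_ge0 ?ler0n.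
have w0 : 0 <= (walks k x)%:R / A ^+ k by rewrite divr_ge0 ?exprn_ge0 ?ler0n.
rewrite mulr_ge0 //= ler_piMr // ler_pdivrMr ?exprn_gt0 ?ltr0n ?card_c4_gt0 // mul1r.
by rewrite -natrX ler_nat -sum_walks (bigD1 x) ?leq_addr.
Qed.

Definition heat_partial (K : nat) (x : 'S_n) : R := \sum_(0 <= k < K.+1) heat_term x k.

Lemma heat_series_cv x : exists l, Un_cv (heat_partial ^~ x) l.
Proof.
have bound k : Rle 0 (heat_term x k) /\ Rle (heat_term x k) (t ^+ k / (k`!)%:R).
  by have /andP[h1 h2] := heat_term_le x k; split; apply/RleP.
have cvB : {l | Un_cv (fun N => sum_f_R0 (fun k => t ^+ k / (k`!)%:R) N) l}.
  by exists (exp t); apply: cv_ext (cv_exp_partial t) => K; rewrite sum_f_R0E.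
have [l cl] := Rseries_CV_comp _ _ bound cvB.
by exists l; apply: cv_ext cl => K; rewrite sum_f_R0E.
Qed.

Definition heat (x : 'S_n) : R := series_val (fun k => Rmult (Rdiv (pow t k) (INR (k`!))) (convpow (@q_c4 n) k x)).

(** [series_val] picks a sum by [epsilon]; domination by the exponential series provides the limit
    that makes this choice the sum. *)
Lemma cv_heat x : Un_cv (heat_partial ^~ x) (heat x).
Proof.
have E K : sum_f_R0 (fun k => Rmult (Rdiv (pow t k) (INR (k`!))) (convpow (@q_c4 n) k x)) K = heat_partial K x.
  rewrite sum_f_R0E; apply: eq_bigr => k _.
  by rewrite convpowE /heat_term RdivE INRE RpowE.
have [l cl] := heat_series_cv x.
have ex : exists l, infinite_sum (fun k => Rmult (Rdiv (pow t k) (INR (k`!))) (convpow (@q_c4 n) k x)) l.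
  by exists l; apply: cv_ext cl => K; rewrite E.
have := epsilon_spec (inhabits 0%R) _ ex; rewrite -/(heat x) => cv.
exact: cv_ext E cv.
Qed.

Variable z : Iirr G -> int.
Hypothesis scal : forall i, \sum_(s in c4 n) 'Chi_i s = ((z i)%:~R)%:M.
Definition ratio i : R := (z i)%:~R / A.

(** Plancherel is applied term by term to partial sums, so that limits only have to pass through
    finite sums. *)
Lemma sum_heat_partial_sq K :
  (n`!)%:R * \sum_x heat_partial K x ^+ 2 = \sum_i (deg i ^ 2)%:R * exp_partial K (t * ratio i) ^+ 2.
Proof.
have sq_sum (u : nat -> R) : (\sum_(0 <= k < K.+1) u k) ^+ 2 = \sum_(0 <= k < K.+1) \sum_(0 <= l < K.+1) u k * u l.
  by rewrite expr2 mulr_suml; apply: eq_bigr => k _; rewrite mulr_sumr.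
under eq_bigr do rewrite sq_sum.
under [RHS]eq_bigr do rewrite sq_sum mulr_sumr.
rewrite exchange_big [RHS]exchange_big /= mulr_sumr; apply: eq_bigr => k _.
under [RHS]eq_bigr do rewrite mulr_sumr.
rewrite exchange_big [RHS]exchange_big /= mulr_sumr; apply: eq_bigr => l _.
pose c : R := t ^+ k / (k`!)%:R * (t ^+ l / (l`!)%:R) / (A ^+ k * A ^+ l).
transitivity (c * ((n`! * \sum_(x : 'S_n) walks k x * walks l x)%N%:Z)%:~R).
  rewrite -pmulrn natrM natr_sum mulrCA; congr (_ * _); rewrite mulr_sumr.
  by apply: eq_bigr => x _; rewrite /heat_term /c natrM invfM; ring.
rewrite (sum_walks_mul k l scal) rmorph_sum mulr_sumr; apply: eq_bigr => i _.
rewrite /c /ratio !rmorphM !rmorphXn /= !exprMn !exprVn invfM -pmulrn; ring.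
Qed.

Lemma sum_heat_partial K : \sum_x heat_partial K x = exp_partial K t.
Proof.
rewrite exchange_big /=; apply: eq_bigr => k _.
rewrite -mulr_sumr -mulr_suml -natr_sum sum_walks natrX divff ?mulr1 //.
by rewrite expf_neq0 ?A_neq0.
Qed.

Lemma sum_heat_sq : (n`!)%:R * \sum_x heat x ^+ 2 = \sum_i (deg i ^ 2)%:R * exp (t * ratio i) ^+ 2.
Proof.
apply: (UL_sequence (fun K => (n`!)%:R * \sum_x heat_partial K x ^+ 2)).
  apply: cvM; first exact: cv_const.
  by apply: cv_sum => x; apply: (cvM (cv_heat x) (cv_heat x)).
apply: (cv_ext (fun K => esym (sum_heat_partial_sq K))).
apply: cv_sum => i; apply: cvM; first exact: cv_const.
exact: (cvM (cv_exp_partial _) (cv_exp_partial _)).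
Qed.

Lemma sum_heat : \sum_x heat x = exp t.
Proof.
apply: (UL_sequence (fun K => \sum_x heat_partial K x)).
  by apply: cv_sum => x; apply: cv_heat.
by apply: (cv_ext (fun K => esym (sum_heat_partial K))); apply: cv_exp_partial.
Qed.

(** Expanding the square leaves the squared norm of the kernel minus 1, and this 1 cancels the
    trivial representation. *)
Lemma dist2_heat :
  dist2 (h_c4 t) (@unif n) = sqrt (\sum_(i | i != 0) (deg i ^ 2)%:R * exp (- (2 * t * (1 - ratio i)))).
Proof.
rewrite /dist2; congr sqrt.
have f0 : (n`!)%:R != 0 :> R by rewrite pnatr_eq0 -lt0n fact_gt0.
have cardG : INR #|[set: 'S_n]| = (n`!)%:R by rewrite INRE cardsT card_Sn.
rewrite cardG -[LHS]/((n`!)%:R * sumS (fun x : 'S_n => pow (Rabs (Rminus (h_c4 t x) (unif x))) 2)).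
rewrite /sumS -[\big[_/_]_(x : 'S_n) _]/(\sum_(x : 'S_n) pow (Rabs (Rminus (h_c4 t x) (unif x))) 2).
have -> : \sum_(x : 'S_n) pow (Rabs (Rminus (h_c4 t x) (unif x))) 2
  = \sum_x (exp (- t) ^+ 2 * heat x ^+ 2 - 2 * (n`!)%:R^-1 * exp (- t) * heat x + ((n`!)%:R^-1) ^+ 2).
  apply: eq_bigr => x _; rewrite RpowE RabsE real_normK ?num_real // RminusE /unif cardG.
  rewrite -[h_c4 t x]/(exp (- t) * heat x) RinvE; ring.
rewrite big_split sumrB /= -!mulr_sumr sum_heat sumr_const cardT -cardE card_Sn.
have ee : exp (- t) * exp t = 1 by rewrite expRD Rplus_opp_l expR0.
transitivity (exp (- t) ^+ 2 * ((n`!)%:R * \sum_x heat x ^+ 2) - 2 * ((n`!)%:R / (n`!)%:R) * (exp (- t) * exp t)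
    + (n`!)%:R / (n`!)%:R * ((n`!)%:R / (n`!)%:R)).
  rewrite -[_ *+ n`!]mulr_natr; ring.
rewrite divff // ee sum_heat_sq (bigD1 0) //=.
have -> : ratio 0 = 1 by rewrite /ratio (c4_scalar0 (scal 0)) -pmulrn divff ?A_neq0.
rewrite deg0 mulr1 mul1r mulrDr -exprMn ee expr1n.
transitivity (exp (- t) ^+ 2 * (\sum_(i | i != 0) (deg i ^ 2)%:R * exp (t * ratio i) ^+ 2)); first ring.
rewrite mulr_sumr; apply: eq_bigr => i _; rewrite mulrCA -exprMn expRD expRX; congr (_ * exp _).
change (Rplus (- t) (t * ratio i)) with (- t + t * ratio i); ring.
Qed.

End Fourier.

(** * Polynomial inequalities behind the spectral gap *)

Lemma short_level_poly (N J : int) : 11 <= N -> 1 <= J -> 5 * J <= 2 * N ->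
  ((N - J) * (N - J - 1)) ^+ 2 - 2 * (2 * N - 3) * ((N - J) * (N - J - 1)) + J * (J ^+ 3 + N ^+ 2)
  <= (N - 2 * J) * ((N - 1) * (N - 2) * (N - 3)).
Proof.
move=> N11 J1 JN; pose U := 2 * N - 5 * J.
have U0 : 0 <= U by rewrite /U; lia.
(* The difference of the two sides vanishes at [J = 0]; [Q0] is 4 times its quotient by [J], in
   terms of [U = 2 N - 5 J]. *)
suff Q0 : 0 <= 7 * J ^+ 3 + 23 * J ^+ 2 * U + 9 * J * U ^+ 2 + U ^+ 3 + 17 * J ^+ 2
   - 10 * J * U - 3 * U ^+ 2 - 68 * J - 8 * U + 24.
  have := mulr_ge0 (le_trans ler01 J1) Q0; rewrite -subr_ge0 => JQ.
  rewrite -subr_ge0 -(pmulr_rge0 _ (isT : 0 < 4 :> int)).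
  by apply: le_trans JQ _; rewrite le_eqVlt; apply/orP; left; apply/eqP; rewrite /U; ring.
have JU : 22 <= 5 * J + U by rewrite /U; lia.
clearbody U; clear JN N11 N.
have h1 : 0 <= (J - 1) * U ^+ 2 by apply: mulr_ge0; [lia | exact: sqr_ge0].
have h2 : 0 <= (J - 1) * (J * U) by apply: mulr_ge0; [lia | apply: mulr_ge0; lia].
have h3 : 0 <= U ^+ 3 by exact: exprn_ge0.
have h4 : 0 <= (J - 1) * U by apply: mulr_ge0; lia.
(* From [J = 3] on, [J ^+ 3] and [J ^+ 2] dominate [- 68 * J]; at [J = 1] the terms in [U] do, as
   [U >= 17]. *)
have [J3 | J3] := lerP 3 J.
  have h5 : 0 <= (J - 3) * J ^+ 2 by apply: mulr_ge0; [lia | exact: sqr_ge0].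
  have h6 : 0 <= (J - 3) * J by apply: mulr_ge0; lia.
  have h7 := sqr_ge0 U.
  move: h1 h2 h3 h4 h5 h6 h7; rewrite !exprS !expr0; lia.
have [JE|JE] : J = 1 \/ J = 2 by lia.
all: rewrite ?JE in JU h1 h2 h4 *.
  have h8 : 17 <= U by lia.
  move: h1 h2 h3 h4; rewrite !exprS !expr0; nia.
have h7 := sqr_ge0 U.
move: h1 h2 h3 h4 h7; rewrite !exprS !expr0; lia.
Qed.

(** For [N = n] and first row [M], these give the bounds [1 / 2] and [(M + 1) / n] on the normalized
    eigenvalue. *)
Lemma long_level_poly (N M : int) : 11 <= N -> 1 <= M -> 5 * M < 3 * N ->
  2 * (M ^+ 3 + N ^+ 2) <= (N - 1) * (N - 2) * (N - 3) /\
  N * (M ^+ 3 + N ^+ 2) <= (M + 1) * ((N - 1) * (N - 2) * (N - 3)).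
Proof.
move=> N11 M1 MN.
have cub : 125 * M ^+ 3 <= 27 * N ^+ 3.
  have : (5 * M) ^+ 3 <= (3 * N) ^+ 3 by rewrite lerXn2r ?nnegrE; lia.
  by rewrite !exprMn.
split.
  have [N13 | N13] := lerP 13 N.
    have h1 : 0 <= (N - 13) * (N * (N - 2)) by apply: mulr_ge0; [lia | apply: mulr_ge0; lia].
    have h2 : 0 <= (N - 13) * N by apply: mulr_ge0; lia.
    move: cub h1 h2; rewrite !exprS !expr0; lia.
  (* For [N = 11] and [N = 12] the bound [cub] is too weak, and integrality of [M] is used
     instead. *)
  have Mle : M <= 6 \/ M <= 7 /\ N = 12 by lia.
  have c6 : M <= 6 -> M ^+ 3 <= 6 ^+ 3 by move=> h; rewrite lerXn2r ?nnegrE; lia.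
  have c7 : M <= 7 -> M ^+ 3 <= 7 ^+ 3 by move=> h; rewrite lerXn2r ?nnegrE; lia.
  have : N = 11 \/ N = 12 by lia.
  move: c6 c7; move: (M ^+ 3) => M3; rewrite !exprS !expr0; move=> c6 c7 [] NE; move: Mle; rewrite NE; lia.
(* The second inequality is a combination of products of the nonnegative [M - 1], [3 N - 5 M] and
   [N - 11]; [d2] controls [N M^3]. *)
have d0 : 0 <= (M - 1) * (3 * N - 5 * M) by apply: mulr_ge0; lia.
have d1 : 0 <= N * ((M - 1) * (3 * N - 5 * M)) by apply: mulr_ge0; [lia | exact: d0].
have d2 : 0 <= M * (N * ((M - 1) * (3 * N - 5 * M))) by apply: mulr_ge0; [lia | exact: d1].
have d3 : 0 <= N * (N * ((M - 1) * (3 * N - 5 * M))) by apply: mulr_ge0; [lia | exact: d1].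
have h1 : 0 <= (N - 11) * (N * (N - 1)) by apply: mulr_ge0; [lia | apply: mulr_ge0; lia].
have h2 : 0 <= (N - 11) * N ^+ 2 by apply: mulr_ge0; [lia | exact: sqr_ge0].
have h3 : 0 <= (N - 11) * N by apply: mulr_ge0; lia.
have h4 : 0 <= (M - 1) * ((N - 11) * N ^+ 2) by apply: mulr_ge0; [lia | exact: h2].
have h5 : 0 <= (M - 1) * ((N - 11) * N) by apply: mulr_ge0; [lia | exact: h3].
have h6 : 0 <= (M - 1) * (N - 11) by apply: mulr_ge0; lia.
move: d1 d2 d3 h1 h3 h4 h5 h6; rewrite !exprS !expr0; lia.
Qed.

(** * Eigenvalues compared with the size of the class *)

Section Ratio.
Variables (n : nat) (z : int) (m : nat) (i : Iirr [set: 'S_n]).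
Hypotheses (le11n : (11 <= n)%N) (m_fr : m = first_row 'Chi_i) (m_lt : (m < n)%N).
Hypothesis scal : \sum_(s in c4 n) 'Chi_i s = (z%:~R)%:M.

Lemma c4_ratio_short : (5 * (n - m) <= 2 * n)%N ->
  n%:Z * z <= (n%:Z - 2 * (n - m)%:Z) * (#|c4 n|)%:Z.
Proof.
move=> short; have [bound _] := c4_scalar_bounds le11n m_fr scal.
have card : 4 * (#|c4 n|)%:Z = n%:Z * ((n%:Z - 1) * (n%:Z - 2) * (n%:Z - 3)).
  by rewrite card_c4 ?(leq_trans _ le11n) // !mulrA.
have := @short_level_poly n%:Z (n - m)%:Z ltac:(lia) ltac:(lia) ltac:(lia).
have -> : n%:Z - (n - m)%:Z = m%:Z by lia.
move=> /(le_trans bound) poly.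
rewrite -(ler_pM2l (isT : 0 < 4 :> int)) mulrCA [leRHS]mulrCA card.
rewrite [leRHS]mulrCA; apply: ler_wpM2l => //.
Qed.

Lemma c4_ratio_long : (2 * n < 5 * (n - m))%N ->
  2 * z <= (#|c4 n|)%:Z /\ n%:Z * z <= (m%:Z + 1) * (#|c4 n|)%:Z.
Proof.
move=> long; have [_ bound] := c4_scalar_bounds le11n m_fr scal.
have card : 4 * (#|c4 n|)%:Z = n%:Z * ((n%:Z - 1) * (n%:Z - 2) * (n%:Z - 3)).
  by rewrite card_c4 ?(leq_trans _ le11n) // !mulrA.
have m_gt0 : (0 < m)%N by rewrite m_fr first_row_gt0 ?deg_gt0 //; lia.
have [p1 p2] := @long_level_poly n%:Z m%:Z ltac:(lia) ltac:(lia) ltac:(lia).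
have n0 : 0 <= n%:Z by [].
split; rewrite -(ler_pM2l (isT : 0 < 4 :> int)).
  rewrite card mulrCA; apply: le_trans (ler_wpM2l n0 p1).
  by rewrite [leRHS]mulrCA ler_pM2l.
rewrite mulrCA [leRHS]mulrCA card [leRHS]mulrCA; apply: ler_wpM2l => //.
exact: le_trans bound p2.
Qed.

End Ratio.

(** * Elementary numerical estimates *)

Lemma ffact_le_exp n k : (n ^_ k <= n ^ k)%N.
Proof.
elim: k => // k IHk; rewrite ffactnSr expnSr leq_mul //; exact: leq_subr.
Qed.

Lemma bin_le_exp n k : ('C(n, k) <= n ^ k)%N.
Proof.
by apply: leq_trans (ffact_le_exp n k); rewrite -bin_ffact leq_pmulr ?fact_gt0.
Qed.

Lemma sum_deg_sq_le n m : (m <= n)%N ->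
  (\sum_(i : Iirr [set: 'S_n] | first_row 'Chi_i == m) deg i ^ 2 <= 'C(n, m) * n ^ (n - m))%N.
Proof.
move=> le_mn; have := sum_deg_sq_first_row n m; rewrite -big_distrl /= -(ffact_fact (leq_subr m n)).
rewrite subKn // mulnA leq_pmul2r ?fact_gt0 // => /leq_trans; apply.
by rewrite leq_mul2l ffact_le_exp orbT.
Qed.

Lemma exp_le (x y : R) : x <= y -> exp x <= exp y.
Proof.
rewrite le_eqVlt => /orP[/eqP->//|/RltP lt_xy]; apply/ltW/RltP; exact: exp_increasing.
Qed.

Lemma exp_gt0 (x : R) : 0 < exp x. Proof. exact/RltP/exp_pos. Qed.

Lemma exp1_ge : 64%:R / 25%:R <= exp 1 :> R.
Proof.
(* The eighth power of [9/8] just exceeds [64/25], which makes [2 / e] at most [25/32]. *)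
have e8 : 9%:R / 8%:R <= exp (8%:R^-1) :> R.
  have : 1 + 8%:R^-1 <= exp (8%:R^-1) :> R by apply/RleP; exact: exp_ineq1_le.
  by apply: le_trans; lra.
have -> : exp 1 = exp (8%:R^-1) ^+ 8 by rewrite expRX; congr exp; rewrite -[RHS]mulr_natr mulVf ?pnatr_eq0.
apply: le_trans (lerXn2r 8 _ _ e8); rewrite ?nnegrE; [lra | lra | exact: ltW (exp_gt0 _)].
Qed.

Lemma expN1_le : exp (- 1) <= 25%:R / 64%:R :> R.
Proof.
have := exp1_ge; rewrite -(ler_pM2l (exp_gt0 (- 1))) expRD Rplus_opp_l expR0; lra.
Qed.

Lemma expN4_le : exp (- 4%:R) <= 16%:R^-1 :> R.
Proof.
have -> : - 4%:R = (- 1) *+ 4 :> R by rewrite mulNrn.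
rewrite -expRX; apply: le_trans (lerXn2r 4 _ _ expN1_le) _; rewrite ?nnegrE; [exact: ltW (exp_gt0 _) | lra | lra].
Qed.

(** The sequence decreases from [n = 11] on, where it is about 0.73. *)
Lemma nat_geom_le n : (11 <= n)%N -> n%:R * (25%:R / 32%:R) ^+ n <= 3%:R / 4%:R :> R.
Proof.
elim: n => // n IHn; rewrite leq_eqVlt => /orP[/eqP<-|]; first lra.
rewrite ltnS => le11n; have := IHn le11n; rewrite exprS -natr1.
have n11 : 11%:R <= n%:R :> R by rewrite ler_nat.
have p0 : 0 <= (25%:R / 32%:R) ^+ n :> R by apply: exprn_ge0; lra.
move: (_ ^+ n) p0 => p p0 h.
have := mulr_ge0 p0 (_ : 0 <= n%:R - 11%:R); rewrite subr_ge0 => /(_ n11); nra.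
Qed.

Lemma geom_le (a : R) n : 0 <= a <= 16%:R^-1 -> \sum_(k < n) a ^+ k.+1 <= 15%:R^-1.
Proof.
(* This stronger bound survives adding the next term because [16 a <= 1]. *)
move=> /andP[a0 a16]; apply: (@le_trans _ _ ((1 - a ^+ n) / 15%:R)); last first.
  have := exprn_ge0 n a0; lra.
elim: n => [|n IHn]; first by rewrite big_ord0 expr0 subrr mul0r.
rewrite big_ord_recr /=; apply: le_trans (lerD IHn (lexx _)) _.
have := exprn_ge0 n a0; rewrite exprS; move: (a ^+ n) => p p0; nra.
Qed.

Lemma exponent_le_short (g l j : R) :
  0 <= l -> 2 * j <= g -> - (g * (l + 2)) <= - 4%:R * j + - l * (2 * j).
Proof.
move=> l0 h; have := ler_wpM2r (addr_ge0 l0 (ler0n R 2)) h; lra.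
Qed.

(** The bound [N / 2] on the gap is used against the summand 2, and [j - 1] against [l]. *)
Lemma exponent_le_long (g l j N : R) :
  0 <= l -> N / 2 <= g -> j - 1 <= g -> - (g * (l + 2)) <= l + - 1 * N + - l * j.
Proof. by move=> l0 h1 h2; have := ler_wpM2r l0 h2; lra. Qed.

(** The excess [c - 2] multiplies a gap of at least 2, which reduces the estimate to the time with
    [c = 2]. *)
Lemma time_exponent_le (N l c t r : R) : 2 <= c -> N / 2 * (l + c) <= t -> 0 <= r ->
  2 <= N * r -> - (2 * t * r) <= - (2 * (c - 2)) + - (N * r * (l + 2)).
Proof.
move=> c2 ht r0 g2; have h1 := ler_wpM2r r0 ht.
have := ler_wpM2r (_ : 0 <= c - 2) g2; rewrite subr_ge0 => /(_ c2); lra.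
Qed.

(** * Summation over the levels *)

Section Main.
Variable n : nat.
Hypothesis le11n : (11 <= n)%N.
Variable z : Iirr [set: 'S_n] -> int.
Hypothesis scal : forall i, \sum_(s in c4 n) 'Chi_i s = ((z i)%:~R)%:M.
Implicit Type i : Iirr [set: 'S_n]%G.
Local Notation N := (n%:R : R).
Local Notation L := (ln N : R).
Local Notation gap i := (N * (1 - ratio z i)).

Let N_gt0 : 0 < N. Proof. by rewrite ltr0n; lia. Qed.
Let A_gt0 : 0 < (#|c4 n|)%:R :> R. Proof. by rewrite ltr0n card_c4_gt0. Qed.

Lemma first_row_lt i : i != 0 -> (first_row 'Chi_i < n)%N.
Proof.
move=> nz; rewrite ltn_neqAle first_row_le andbT; apply: contra_neq nz.
exact: first_row_eq_n.
Qed.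

Lemma ln_ge0 : 0 <= L.
Proof.
have <- : ln 1 = 0 :> R by exact: ln_1.
have : 1 <= N by rewrite ler1n; lia.
rewrite le_eqVlt => /orP[/eqP<- //|/RltP lt1]; apply/ltW/RltP/ln_increasing => //; exact: Rlt_0_1.
Qed.

Lemma exp_ln_opp : exp (- L) = N^-1.
Proof. rewrite exp_Ropp exp_ln //; exact/RltP. Qed.

Lemma gap_cases i (j := (n - first_row 'Chi_i)%N) : i != 0 ->
  2 * j%:R <= gap i \/ (N / 2 <= gap i /\ j%:R - 1 <= gap i).
Proof.
move=> nz; have fr_lt := first_row_lt nz; rewrite /ratio.
have gapE : N * (1 - (z i)%:~R / (#|c4 n|)%:R) = N - (n%:Z * z i)%:~R / (#|c4 n|)%:R :> R.
  by rewrite rmorphM /= -pmulrn; ring.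
rewrite gapE; have [short | long] := leqP (5 * j)%N (2 * n)%N; [left | right].
  have := c4_ratio_short le11n (erefl _) fr_lt (scal i) short.
  rewrite -/j -(ler_int R) [leRHS]rmorphM rmorphB /= -ler_pdivrMr ?rmorphM //=; first by lra.
have [b1 b2] := c4_ratio_long le11n (erefl _) fr_lt (scal i) long.
move: b1 b2; rewrite -!(ler_int R) !(rmorphM, rmorphD) /= -!pmulrn.
have -> : (first_row 'Chi_i)%:R = N - j%:R :> R by rewrite /j natrB ?subKr // ltnW.
move=> b1 b2.
have h1 : (z i)%:~R / (#|c4 n|)%:R <= 2%:R^-1 :> R by rewrite ler_pdivrMr //; lra.
have h2 : N * (z i)%:~R / (#|c4 n|)%:R <= N - j%:R + 1 :> R by rewrite ler_pdivrMr.
split; last by lra.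
have := ler_wpM2l (ltW N_gt0) h1; rewrite mulrA; lra.
Qed.

(* The two terms dominate [exp (- gap * (ln n + 2))] in the two cases of [gap_cases]. *)
Definition weight (j : nat) : R :=
  exp (- 4%:R) ^+ j * N^-1 ^+ (2 * j) + N * exp (- 1) ^+ n * N^-1 ^+ j.

Lemma weight_ge0 j : 0 <= weight j.
Proof.
by rewrite addr_ge0 // !mulr_ge0 ?exprn_ge0 ?invr_ge0 ?ler0n // ltW ?exp_gt0.
Qed.

Lemma gap_ge2 i : i != 0 -> 2 <= gap i.
Proof.
move=> nz; have fr_lt := first_row_lt nz; case: (gap_cases nz) => [h | [h _]]; apply: le_trans h.
  have : 1 <= (n - first_row 'Chi_i)%:R :> R by rewrite ler1n; lia.
  lra.
have : 11%:R <= N by rewrite ler_nat.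
lra.
Qed.

Lemma exp_gap_le i : i != 0 ->
  exp (- (gap i * (L + 2))) <= weight (n - first_row 'Chi_i).
Proof.
move=> nz; have L0 := ln_ge0; rewrite /weight -exp_ln_opp; set j := (n - _)%N.
have w1 : 0 <= exp (- 4%:R) ^+ j * exp (- L) ^+ (2 * j).
  by rewrite mulr_ge0 ?exprn_ge0 // ltW ?exp_gt0.
have w2 : 0 <= N * exp (- 1) ^+ n * exp (- L) ^+ j.
  by rewrite !mulr_ge0 ?exprn_ge0 ?ler0n // ltW ?exp_gt0.
case: (gap_cases nz) => [h | [h1 h2]].
  rewrite -/j in h; rewrite -[leLHS]addr0; apply: lerD => //; rewrite !expRX expRD; apply: exp_le.
  rewrite -(mulr_natr _ j) -(mulr_natr _ (2 * j)) natrM.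
  exact: exponent_le_short.
rewrite -/j in h2; rewrite -[leLHS]add0r; apply: lerD => //.
have NE : N = exp L by rewrite exp_ln //; apply/RltP.
rewrite [X in _ <= X * _ * _]NE.
rewrite !expRX !expRD; apply: exp_le.
rewrite -(mulr_natr (- L)) -(mulr_natr (- 1)).
exact: exponent_le_long.
Qed.

(** The dimension bound is ['C(n, m)] times [N ^+ j]. In the first term the binomial is bounded by a
    second [N ^+ j]; in the second it is kept, to be summed to [2 ^+ n]. *)
Lemma level_weight_le m : (m < n)%N ->
  (\sum_(i : Iirr [set: 'S_n] | first_row 'Chi_i == m) deg i ^ 2)%N%:R * weight (n - m)
   <= exp (- 4%:R) ^+ (n - m) + N * exp (- 1) ^+ n * ('C(n, m))%:R.
Proof.
move=> lt_mn; set j := (n - m)%N.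
have dim : (\sum_(i : Iirr [set: 'S_n] | first_row 'Chi_i == m) deg i ^ 2)%N%:R <= ('C(n, m))%:R * N ^+ j :> R.
  by rewrite -natrX -natrM ler_nat sum_deg_sq_le // ltnW.
have bin : ('C(n, m))%:R <= N ^+ j.
  by rewrite -natrX ler_nat -bin_sub ?bin_le_exp // ltnW.
have q0 : 0 < N^-1 by rewrite invr_gt0.
have e4 := exp_gt0 (- 4%:R); have e1 := exp_gt0 (- 1).
apply: le_trans (ler_wpM2r _ dim) _.
  by rewrite addr_ge0 ?mulr_ge0 ?exprn_ge0 // ltW.
rewrite mulrDr; apply: lerD.
  rewrite mulrCA ler_piMr ?exprn_ge0 //; first exact: ltW.
  have q2 : N ^+ j * N ^+ j * N^-1 ^+ (2 * j) = 1.
    by rewrite -exprD addnn mul2n -exprMn divff ?expr1n ?gt_eqF.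
  rewrite -[leRHS]q2; apply: ler_wpM2r; first by rewrite exprn_ge0 // ltW.
  by apply: ler_wpM2r; first by rewrite exprn_ge0 // ltW.
have qN : N ^+ j * N^-1 ^+ j = 1 by rewrite -exprMn divff ?expr1n ?gt_eqF.
rewrite le_eqVlt; apply/orP; left; apply/eqP.
transitivity (N * exp (- 1) ^+ n * ('C(n, m))%:R * (N ^+ j * N^-1 ^+ j)); first ring.
by rewrite qN mulr1.
Qed.

Lemma sum_weight_le :
  \sum_(i : Iirr [set: 'S_n] | i != 0) (deg i ^ 2)%:R * weight (n - first_row 'Chi_i) <= 1.
Proof.
pose fr i : 'I_n.+1 := inord (first_row 'Chi_i).
have frE i : fr i = first_row 'Chi_i :> nat by rewrite inordK // ltnS first_row_le.
(* Level [n] holds only the trivial representation, so its part of the sum is empty. *)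
rewrite (partition_big fr xpredT) //= big_ord_recr /= [X in _ + X]big1 ?addr0; last first.
  move=> i /andP[nz /eqP/(congr1 val)/=]; rewrite frE => fri.
  by have := first_row_lt nz; rewrite fri ltnn.
have level (m : 'I_n) :
    \sum_(i : Iirr [set: 'S_n] | (i != 0) && (fr i == widen_ord (leqnSn n) m)) (deg i ^ 2)%:R * weight (n - first_row 'Chi_i)
    <= exp (- 4%:R) ^+ (n - m) + N * exp (- 1) ^+ n * ('C(n, m))%:R.
  apply: le_trans (level_weight_le (ltn_ord m)); rewrite natr_sum mulr_suml.
  rewrite [leRHS](bigID (fun i : Iirr [set: 'S_n] => i != 0)) /= -[leLHS]addr0; apply: lerD; last first.
    by apply: sumr_ge0 => i _; rewrite mulr_ge0 ?ler0n ?weight_ge0.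
  rewrite le_eqVlt; apply/orP; left; apply/eqP; apply: eq_big => [i | i /andP[_ /eqP fri]].
    by rewrite andbC -val_eqE /= frE.
  by move/(congr1 val): fri; rewrite /= frE => ->.
apply: le_trans (ler_sum _ (fun m _ => level m)) _; rewrite big_split /= -mulr_sumr.
have geo : \sum_(m < n) exp (- 4%:R) ^+ (n - m) <= 15%:R^-1.
  rewrite (reindex_inj rev_ord_inj) /=.
  rewrite (eq_bigr (fun m : 'I_n => exp (- 4%:R) ^+ m.+1)) => [|m _]; last first.
    by rewrite subKn.
  by apply: geom_le; rewrite expN4_le ltW ?exp_gt0.
have binsum : \sum_(m < n) ('C(n, m))%:R <= 2 ^+ n :> R.
  rewrite -natr_sum -natrX ler_nat -[2%N]/(1 + 1)%N expnDn big_ord_recr /=.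
  apply: leq_trans (leq_addr _ _); apply: leq_sum => m _.
  by rewrite !exp1n !muln1.
have half : N * exp (- 1) ^+ n * \sum_(m < n) ('C(n, m))%:R <= 3%:R / 4%:R.
  apply: le_trans (nat_geom_le le11n); rewrite -mulrA ler_wpM2l ?ler0n //.
  apply: le_trans (ler_wpM2l _ binsum) _; first by rewrite exprn_ge0 // ltW ?exp_gt0.
  rewrite -exprMn lerXn2r ?nnegrE ?mulr_ge0 ?(ltW (exp_gt0 _)) //; first lra.
  by have := expN1_le; lra.
(* The two parts add up to at most [1/15 + 3/4]. *)
by move: geo half; lra.
Qed.

Lemma dist2_h_c4_le (c t : R) : 2 <= c -> N / 2 * (L + c) <= t ->
  dist2 (h_c4 t) (@unif n) <= exp (- (c - 2)).
Proof.
move=> c2 t_ge; have L0 := ln_ge0; have N0 := N_gt0.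
have t0 : 0 <= t.
  by apply: le_trans t_ge; rewrite mulr_ge0 ?addr_ge0 ?divr_ge0 ?(ltW N0) // (le_trans _ c2).
rewrite (dist2_heat le11n t0 scal).
have sqE : exp (- (c - 2)) ^+ 2 = exp (- (2 * (c - 2))).
  by rewrite expRX; congr exp; rewrite -(mulr_natr (- (c - 2))); ring.
rewrite RsqrtE -[leRHS](ger0_norm (ltW (exp_gt0 _))) -sqrtr_sqr ler_wsqrtr // sqE.
apply: le_trans (_ : exp (- (2 * (c - 2))) * \sum_(i : Iirr [set: 'S_n] | i != 0) (deg i ^ 2)%:R * weight (n - first_row 'Chi_i) <= _).
  rewrite mulr_sumr; apply: ler_sum => i nz.
  rewrite mulrCA ler_wpM2l ?ler0n //.
  apply: le_trans (ler_wpM2l (ltW (exp_gt0 _)) (exp_gap_le nz)).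
  rewrite expRD; apply: exp_le.
  change (- (2 * t * (1 - ratio z i)) <= - (2 * (c - 2)) + - (gap i * (L + 2))).
  have g2 := gap_ge2 nz; have r0 : 0 <= 1 - ratio z i.
    by rewrite -(pmulr_rge0 _ N0); apply: le_trans g2.
  exact: time_exponent_le.
by rewrite ler_piMr ?(ltW (exp_gt0 _)) // sum_weight_le.
Qed.

End Main.

Lemma c4_scalar_family n : (0 < n)%N ->
  exists z : Iirr [set: 'S_n] -> int, forall i, \sum_(s in c4 n) 'Chi_i s = ((z i)%:~R)%:M.
Proof.
move=> n_gt0; have ex (i : Iirr [set: 'S_n]) :
    exists z : int, \sum_(s in c4 n) 'Chi_i s = (z%:~R)%:M.
  by have [z [e [h _ _ _]]] := c4_scalar i n_gt0; exists z.
exact: fin_all_exists ex.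
Qed.

Bind Scope R_scope with R.
Local Open Scope R_scope.

Theorem theorem5p7 (n : nat) (c t : R) :
  leq 11 n ->
  2 <= c ->
  INR n / 2 * (ln (INR n) + c) <= t ->
  @dist2 n (@h_c4 n t) (@unif n) <= exp (- (c - 2)).
Proof.
have -> : IZR 2 = GRing.natmul (GRing.one R) 2 by rewrite IZRposE INRE.
move=> le11n /RleP c2 /RleP t_ge; apply/RleP.
have [z scal] := c4_scalar_family (leq_trans (isT : leq 1 11) le11n).
apply: (dist2_h_c4_le le11n scal c2).
by rewrite INRE RdivE in t_ge.
Qed.
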